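(* Let $u$ be the (sufficiently smooth) solution of $u'(t)+Au(t)+Bu(t)=f(t)$, $t\in(0,T]$, $u(0)=u^0$. Let $U^n$, $n=2,3,\dots,N$, be the solution sequence of the variable step-size BDF2 scheme $\bar\partial_B^2U^n+AU^n+BU^n=f^n$ ($n=2,\dots,N$), $U^0=u^0$, and let the starting value $U^1$ be computed by the backward Euler method $$\frac{U^1-U^0}{k_1}+AU^1+BU^1=f^1$$ with $k_1$ satisfying $\gamma^2(t^1)k_1<1$. Let $e^n=u(t^n)-U^n$, and let $n\in\{2,\dots,N\}$. (i) Let $r_{\max}\le R$ with $1<R<R_1=(3+\sqrt{17})/2\approx3.561$, and let $c_R>\max\big\{\frac{2+2R}{2+R},\frac{2+2R}{2+3R-R^2}\big\}$. If there exists a constant $c_1$ such that $k_{\max}$ satisfies $c_R\gamma^2k_{\max}\le c_1<1$, then $$\|e\|^2_{l^2(t^1,t^n;V)}+\|e\|^2_{l^\infty(t^1,t^n;V)}\le C(k_{\max}^4+k_1^3),$$ where $C$ depends only on $C_2$, $t^n$, $c_4$, $c_5$, $c_6$ and $c_R$, with $C_2=\frac{c_R}{1-c_1}\exp\big(\frac{c_R}{1-c_1}\sum_{j=2}^n\gamma^2(t^j)k_j\big)$. (ii) If $r_{\max}\le R$ with $1<R<R_0=\sqrt2+1\approx2.414$, and if there exists a constant $c_1$ such that $k_{\max}$ satisfies $(4+2\sqrt2)\gamma^2k_{\max}\le c_1<1$, then $$\|e\|^2_{l^2(t^1,t^n;H,H)}+\|e\|^2_{l^\infty(t^1,t^n;V)}\le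 C(k_{\max}^4+k_1^3),$$ where $C$ depends only on $C_1$, $t^n$, $c_4$, $c_5$, $c_6$ and $r_2$, with $C_1=\frac{4+2\sqrt2}{1-c_1}\exp\big(\frac{4+2\sqrt2}{1-c_1}\sum_{j=2}^n\gamma^2(t^j)k_j\big)$. (iii) Let $r_{\max}\le R$ with $1<R<R_0=\sqrt2+1\approx2.414$, and set $c_3=\frac{(1+R)^2}{1+2R-R^2}$. If there exist constants $c_1$ and $c_2$ such that $k_{\max}$ satisfies $(4+2\sqrt2)\gamma^2k_{\max}\le c_1<1$ and $2c_3\gamma^2k_{\max}\le c_2<1$, then $$|e|^2_{l^\infty(t^1,t^n;H)}+\|e\|^2_{l^2(t^1,t^n;V)}\le C(k_1^4+k_{\max}^4),$$ where $C$ depends only on $\gamma$, $c_i$ ($i=1,\dots,6$), $R$, $t^n$ and $\Phi_n:=\sum_{j=2}^{n-2}[r_j-r_{j+2}]_+$, $[x]_+:=\frac{|x|+x}2$.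
   Context: Let $(H,(\cdot,\cdot))$ be a Hilbert space with norm $|\cdot|$, and $A:D(A)\to H$ a positive definite, self-adjoint, linear operator with $D(A)$ dense in $H$. Let $V=D(A^{1/2})$ with norm $\|v\|=|A^{1/2}v|=(Av,v)^{1/2}$, and let $V^*$ be its dual, $V\subset H\subset V^*$, with norm $\|v\|_*=|A^{-1/2}v|$; $(\cdot,\cdot)$ also denotes the duality pairing between $V^*$ and $V$. $B$ is a linear operator with $|Bu|\le\gamma(t)\|u\|$ for all $u\in V$, $t\in J:=(0,T]$, where $\gamma:J\to\mathbb R$ is a smooth nonnegative function, and (without argument) $\gamma:=\max_{t\in J}\gamma(t)$. $f:[0,T]\to H$. Partition: $N\ge2$, $0=t^0<t^1<\dots<t^N=T$, $k_n=t^n-t^{n-1}$, $r_n=k_n/k_{n-1}$ and $s_n=r_n/(1+r_n)=k_n/(k_n+k_{n-1})$ for $n\ge2$; $k_{\max}=\max_{2\le n\le N}k_n$, $r_{\max}=\max_{2\le n\le N}r_n$; $f^n=f(t^n)$. Difference operators: $\bar\partial U^n=(U^n-U^{n-1})/k_n$ and $\bar\partial_B^2U^n=(1+s_n)\bar\partial U^n-s_n\bar\partial U^{n-1}$. The schemes are understood in variational form (tested with all $v\in V$), with $U^n\in V$. Constants (all determined by derivatives of the exact solution $u$, which is assumed regular enough for the bounds to hold): $c_4$ is the constant in the consistency bound $|d_2^n|\le c_4k_n^2$, $n\ge2$, where $d_2^n=\bar\partial_B^2u(t^n)-u'(t^n)$; $c_5$ is the constant in the first-step estimate $|e^1|\le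 c_5k_1^2$; $c_6$ is the constant in $\big|k_1[\bar\partial u^1-u'(t^1)]\big|=\big|\int_0^{t^1}s\,u''(s)\,ds\big|\le c_6k_1^2$, where $u^n=u(t^n)$. Norms: $|e|_{l^\infty(t^{n_1},t^{n_2};H)}=\max_{n_1\le j\le n_2}|e^j|$, $\|e\|_{l^\infty(t^{n_1},t^{n_2};V)}=\max_{n_1\le j\le n_2}\|e^j\|$, $\|e\|_{l^2(t^{n_1},t^{n_2};V)}=\big(\sum_{j=n_1}^{n_2}k_j\|e^j\|^2\big)^{1/2}$, and $\|e\|_{l^2(t^{n_1},t^{n_2};H,H)}=\big(\sum_{j=n_1}^{n_2-1}k_js_j|\bar\partial e^j|^2\big)^{1/2}$, where the weight $s_1$ (if $n_1=1$) is any fixed number in $[0,1]$. Empty sums are $0$. *)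

(* Defs.v *)
From HB Require Import structures.
From mathcomp Require Import all_boot all_order all_algebra.
From mathcomp Require Import all_classical all_reals all_analysis.

Set Implicit Arguments.
Unset Strict Implicit.
Unset Printing Implicit Defensive.

Import Order.TTheory GRing.Theory Num.Theory.
Import numFieldNormedType.Exports.

Local Open Scope classical_set_scope.
Local Open Scope ring_scope.

(* A real Hilbert space is a complete normed space [H] whose norm is induced by
   a positive definite symmetric bilinear form. *)
Definition hilbert (R : realType) (H : completeNormedModType R)
    (ip : {dot H for (@idfun R)}) : Prop :=
  forall x : H, `|x| ^+ 2 = ip x x.

(* A linear operator defined on a subspace [dom] only; the values of the
   underlying total function outside [dom] are irrelevant. *)
Record linop (R : realType) (H : lmodType R) := LinOp {
  dom : set H ;
  app :> H -> H ;
  dom0 : dom 0 ;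
  domP : forall a x y, dom x -> dom y -> dom (a *: x + y) ;
  appP : forall a x y, dom x -> dom y -> app (a *: x + y) = a *: app x + app y
}.

Section Operators.
Variables (R : realType) (H : completeNormedModType R).
Variable ip : {dot H for (@idfun R)}.
Implicit Types A sqrtA : linop H.

(* Densely defined, and the graph of A coincides with the graph of its
   adjoint. *)
Definition self_adjoint A : Prop :=
  dense (dom A) /\
  forall y z : H,
    (dom A y /\ A y = z) <-> (forall x, dom A x -> ip (A x) y = ip x z).

Definition pos_definite A : Prop :=
  forall v, dom A v -> v != 0 -> 0 < ip (A v) v.

(* sqrtA = A^{1/2}: the (unique) nonnegative self-adjoint operator whose square,
   with domain {x in dom sqrtA | sqrtA x in dom sqrtA}, is A. *)
Definition is_sqrt_op A sqrtA : Prop :=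
  [/\ self_adjoint sqrtA,
      forall v, dom sqrtA v -> 0 <= ip (sqrtA v) v,
      forall x, dom A x <-> (dom sqrtA x /\ dom sqrtA (sqrtA x)) &
      forall x, dom A x -> A x = sqrtA (sqrtA x)].

(* V = D(A^{1/2}) is dom sqrtA, and ||v|| = |A^{1/2} v|. *)
Definition normV sqrtA (v : H) : R := `|sqrtA v|.

End Operators.

Section Calculus.
Variables (R : realType) (W : normedModType R).

(* g has derivative l at x relative to D (one-sided at the end points of an
   interval D). *)
Definition deriv_within (D : set R) (g : R -> W) (x : R) (l : W) : Prop :=
  (fun y : R => (y - x)^-1 *: (g y - g x)) @ within D (x^') --> l.

Definition smooth_on (D : set R) (g : R -> W) : Prop :=
  exists G : nat -> R -> W,
    (forall x, D x -> G 0%N x = g x) /\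
    (forall m x, D x -> deriv_within D (G m) x (G m.+1 x)).

End Calculus.

Definition is_max_on (R : realType) (D : set R) (g : R -> R) (m : R) : Prop :=
  (exists2 x, D x & g x = m) /\ (forall x, D x -> g x <= m).

Section Grid.
Variables (R : realType) (t : nat -> R).

Definition partition (N : nat) (T : R) : Prop :=
  [/\ t 0%N = 0, t N = T & forall j, (j < N)%N -> t j < t j.+1].

Definition stp (n : nat) : R := t n - t n.-1.
Definition rat_stp (n : nat) : R := stp n / stp n.-1.
Definition s_stp (n : nat) : R := rat_stp n / (1 + rat_stp n).

(* The maximised quantities are positive, so 0 is a harmless default. *)
Definition stp_max (N : nat) : R := \big[Num.max/0]_(2 <= j < N.+1) stp j.
Definition rat_max (N : nat) : R := \big[Num.max/0]_(2 <= j < N.+1) rat_stp j.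

Definition pos_part (x : R) : R := (`|x| + x) / 2.
Definition Phi (n : nat) : R :=
  \sum_(2 <= j < n.-1) pos_part (rat_stp j - rat_stp j.+2).

Definition gronwall (gamma : R -> R) (a c1 : R) (n : nat) : R :=
  a / (1 - c1) *
  expR (a / (1 - c1) * \sum_(2 <= j < n.+1) gamma (t j) ^+ 2 * stp j).

Section Differences.
Variable H : normedModType R.
Implicit Types e U : nat -> H.

Definition bdiff U (n : nat) : H := (stp n)^-1 *: (U n - U n.-1).
Definition bdf2 U (n : nat) : H :=
  (1 + s_stp n) *: bdiff U n - s_stp n *: bdiff U n.-1.

Definition linf (nrm : H -> R) e (n1 n2 : nat) : R :=
  \big[Num.max/0]_(n1 <= j < n2.+1) nrm (e j).
Definition l2 (nrm : H -> R) e (n1 n2 : nat) : R :=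
  Num.sqrt (\sum_(n1 <= j < n2.+1) stp j * nrm (e j) ^+ 2).

(* s_1 is not determined by the grid; [s1] is its prescribed value. *)
Definition l2HH (s1 : R) e (n1 n2 : nat) : R :=
  Num.sqrt (\sum_(n1 <= j < n2)
    stp j * (if j == 1%N then s1 else s_stp j) * `|bdiff e j| ^+ 2).

End Differences.
End Grid.

(* sqrtA stands for A^{1/2}, du for u', gmax for the maximum of gamma.  B may
   depend on time, as its bound gamma does; a fixed operator is the case of a
   constant family.  The duality pairing (A w, v) for w, v in V is
   ip (sqrtA w) (sqrtA v).  The fields set_c4, set_c5, set_c6 are the bounds
   that fix the meaning of the constants c4, c5, c6. *)
Record bdf2_setting (R : realType) (H : completeNormedModType R)
    (ip : {dot H for (@idfun R)}) (A sqrtA : linop H) (B : R -> H -> H)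
    (gamma : R -> R) (gmax T : R) (f u du : R -> H)
    (N : nat) (t : nat -> R) (U : nat -> H) (c4 c5 c6 : R) : Prop :=
  Bdf2Setting {
  set_hilbert : hilbert ip ;
  set_adj : self_adjoint ip A ;
  set_pos : pos_definite ip A ;
  set_sqrt : is_sqrt_op ip A sqrtA ;
  set_gamma_smooth : smooth_on `]0, T] (gamma : R -> R^o) ;
  set_gamma_ge0 : forall x, x \in `]0, T] -> 0 <= gamma x ;
  set_gmax : is_max_on `]0, T] gamma gmax ;
  set_B_linear : forall x, x \in `]0, T] -> forall a v w,
    dom sqrtA v -> dom sqrtA w -> B x (a *: v + w) = a *: B x v + B x w ;
  set_B_bound : forall x, x \in `]0, T] -> forall v, dom sqrtA v ->
    `|B x v| <= gamma x * normV sqrtA v ;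
  set_N : (2 <= N)%N ;
  set_part : partition t N T ;
  set_u_cont : {within `[0, T], continuous u} ;
  set_u_dom : forall x, x \in `]0, T] -> dom A (u x) ;
  set_u_deriv : forall x, x \in `]0, T] -> deriv_within `[0, T] u x (du x) ;
  set_u_eq : forall x, x \in `]0, T] -> du x + A (u x) + B x (u x) = f x ;
  set_U_V : forall n, (n <= N)%N -> dom sqrtA (U n) ;
  set_U0 : U 0%N = u 0 ;
  set_gamma_k1 : gamma (t 1%N) ^+ 2 * stp t 1 < 1 ;
  set_euler : forall v, dom sqrtA v ->
    ip (bdiff t U 1) v + ip (sqrtA (U 1%N)) (sqrtA v)
      + ip (B (t 1%N) (U 1%N)) v = ip (f (t 1%N)) v ;
  set_bdf2 : forall n, (2 <= n <= N)%N -> forall v, dom sqrtA v ->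
    ip (bdf2 t U n) v + ip (sqrtA (U n)) (sqrtA v) + ip (B (t n) (U n)) v
    = ip (f (t n)) v ;
  set_c4 : forall n, (2 <= n <= N)%N ->
    `|bdf2 t (u \o t) n - du (t n)| <= c4 * stp t n ^+ 2 ;
  set_c5 : `|u (t 1%N) - U 1%N| <= c5 * stp t 1 ^+ 2 ;
  set_c6 : `|stp t 1 *: (bdiff t (u \o t) 1 - du (t 1%N))| <= c6 * stp t 1 ^+ 2
}.

(* Main.v *)
(** Let [e] be the error, [delta_j] its backward difference quotient, [r_j] the
    step ratios and [s_j = r_j / (1 + r_j)].  Testing the error equation with
    [delta_j] and using [2 (delta', delta) <= 2 |delta|^2 + |delta'|^2 / 2] for
    the coupling to the previous quotient [delta'], the leftover is
    [r^2 / (2 + 2 r) k' |delta'|^2] with [k'] the previous step; it is absorbed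
    by the dissipation of the previous step, and the discrete Gronwall inequality
    bounds [||e^n||^2] together with [sum_j k_j |delta_j|^2].  This gives (i) and
    (ii), the Euler step providing [||e^1||^2 <= 2 c5 c6 k_1^3].

    For (iii), testing with [e^j] shows that [y_j = |e^j|^2 - |e^(j-1)|^2]
    satisfies [y_j + k_j ||e^j||^2 / 2 <= theta_j y_(j-1) + q_j], where
    [theta_j = r_j^2 / (1 + 2 r_j)] is below 1 exactly when [r_j < 1 + sqrt 2].
    Summing this contraction leaves increments
    [|e^j - e^(j-1)|^2 = k_j (k_j |delta_j|^2)] in [q_j]; by the bound of (ii)
    they carry an additional factor [k_j], which turns [k_1^3] into [k_1^4] and
    [k_max^4]. *)

Require Import Defs.
From HB Require Import structures.
From mathcomp Require Import all_boot all_order all_algebra.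
From mathcomp Require Import all_classical all_reals all_analysis.
From mathcomp Require Import ring lra zify.

Import Order.TTheory GRing.Theory Num.Theory.
Import numFieldNormedType.Exports.

Local Open Scope classical_set_scope.
Local Open Scope ring_scope.

(* lia translates every hypothesis, which is slow in the presence of real ones. *)
Ltac nat_lia :=
  repeat match goal with H : ?P |- _ =>
    lazymatch P with
    | nat => fail
    | is_true (leq _ _) => fail
    | is_true (leq _ _ && leq _ _) => fail
    | @eq nat _ _ => fail
    | not (@eq nat _ _) => fail
    | _ => clear H
    end
  end; lia.

(** * Scalar sequences: a discrete Gronwall inequality and a summed contraction *)

Section RealSequences.
Context {R : realType}.
Implicit Types (x y h q lam theta : nat -> R) (b c L Th : R) (m n p : nat).

Lemma sum_nat_ge0 x m n : (forall j, (m <= j < n)%N -> 0 <= x j) ->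
  0 <= \sum_(m <= j < n) x j.
Proof. by move=> x0; rewrite big_nat sumr_ge0. Qed.

Lemma ler_sum_nat_widen x m n p : (m <= n <= p)%N ->
  (forall j, (n <= j < p)%N -> 0 <= x j) ->
  \sum_(m <= j < n) x j <= \sum_(m <= j < p) x j.
Proof.
move=> /andP[mn np] x0.
by rewrite (big_cat_nat mn np) /= lerDl; apply: sum_nat_ge0.
Qed.

(** The hypothesis is implicit: the sum bounding [x m] contains [x m] itself. Since
    [lam m <= L < 1], the newest term can be moved to the left, at the price of a factor
    [1 / (1 - lam m)], which is at most [expR (lam m / (1 - L))]; these factors multiply up to the
    exponential. *)
Lemma discrete_gronwall x lam b L p n : 0 <= b -> L < 1 ->
  (forall j, (p <= j < n)%N -> 0 <= lam j <= L) ->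
  (forall m, (p <= m < n)%N ->
     x m <= b + \sum_(p <= j < m.+1) lam j * x j) ->
  forall m, (p <= m <= n)%N ->
  b + \sum_(p <= j < m) lam j * x j
    <= b * expR ((1 - L)^-1 * \sum_(p <= j < m) lam j).
Proof.
move=> b0 L1 lamL xb; elim=> [|m IHm] /andP[pm mn].
  by rewrite !big_geq// mulr0 expR0 mulr1 addr0.
have [pm'|mp] := leqP p m; last first.
  by rewrite !big_geq// mulr0 expR0 mulr1 addr0.
have /andP[l0 lL] : 0 <= lam m <= L by apply: lamL; rewrite pm' mn.
have := xb m; rewrite pm' mn => /(_ isT).
have := IHm; rewrite pm' ltnW// => /(_ isT).
rewrite !big_nat_recr //=; set S := \sum_(_ <= _ < _) lam _ * _.
set s := \sum_(_ <= _ < _) _ => IH xm.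
rewrite mulrDr expRD.
have e0 := expR_gt0 ((1 - L)^-1 * s).
have e1 := expR_ge1Dx ((1 - L)^-1 * lam m).
have L0 : 0 < 1 - L by rewrite subr_gt0.
set T := b + (S + _).
have TS : (1 - lam m) * T <= b + S.
  rewrite /T; have := ler_wpM2l l0 xm; lra.
(* With [l = lam m] and [expR x >= 1 + x], it suffices that [(1 - l) (1 + l / (1 - L)) - 1 = l (L -
   l) / (1 - L)] is nonnegative. *)
have E1 : 1 <= (1 - lam m) * expR ((1 - L)^-1 * lam m).
  apply: (@le_trans _ _ ((1 - lam m) * (1 + (1 - L)^-1 * lam m))); last first.
    by rewrite ler_wpM2l//; lra.
  rewrite -(ler_pM2l L0) mulrCA mulrDr mulrA mulfV ?gt_eqF//.
  have := ler_wpM2l l0 lL; nra.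
have lm1 : 0 < 1 - lam m by lra.
rewrite -(ler_pM2l lm1); apply: (le_trans TS); apply: (le_trans IH).
rewrite (_ : (1 - lam m) * _ = b * expR ((1 - L)^-1 * s) *
  ((1 - lam m) * expR ((1 - L)^-1 * lam m))); last by ring.
by rewrite ler_peMr ?mulr_ge0// ltW.
Qed.

(* Lyapunov functional: the partial sum of y + h plus Th/(1-Th) max(y m, 0). *)
Lemma sum_contraction y h q theta Th n : 0 <= Th < 1 ->
  (forall j, (2 <= j <= n)%N -> [/\ 0 <= theta j <= Th, 0 <= h j,
     0 <= q j & y j + h j <= theta j * y j.-1 + q j]) ->
  0 <= y 1%N ->
  forall m, (1 <= m <= n)%N ->
  \sum_(2 <= j < m.+1) (y j + h j)
    <= Th / (1 - Th) * y 1%N + (1 - Th)^-1 * \sum_(2 <= j < m.+1) q j.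
Proof.
move=> /andP[Th0 Th1] H y1 m mn.
set W := (1 - Th)^-1.
have W0 : 0 < W by rewrite invr_gt0 subr_gt0.
(* Of the [W] copies of the contracted bound in the induction step, one pays for the new [y + h] and
   [Th * W] pay for the new positive part. *)
have WE : W = 1 + Th * W by rewrite /W; field; lra.
pose yp j := Num.max (y j) 0.
have yp0 j : 0 <= yp j by rewrite /yp le_max lexx orbT.
have yyp j : y j <= yp j by rewrite /yp le_max lexx.
have TW0 : 0 <= Th * W by rewrite mulr_ge0// ltW.
suff: \sum_(2 <= j < m.+1) (y j + h j) + Th * W * yp m
    <= Th * W * y 1%N + W * \sum_(2 <= j < m.+1) q j.
  by have := mulr_ge0 TW0 (yp0 m); lra.
elim: m mn => // -[_ _|m IHm mn].
  rewrite !big_geq// mulr0 add0r addr0.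
  by rewrite (_ : yp 1%N = y 1%N)// /yp max_l.
rewrite !(big_nat_recr m.+2)//=.
have := IHm (ltac:(nat_lia)).
have [/andP[t0 tT] h0 q0 /= yh] := H m.+2 (ltac:(nat_lia)).
have ty : theta m.+2 * y m.+1 <= Th * yp m.+1.
  apply: (@le_trans _ _ (theta m.+2 * yp m.+1)).
    by rewrite ler_wpM2l.
  by rewrite ler_wpM2r.
have yhp : y m.+2 + h m.+2 <= Th * yp m.+1 + q m.+2 by lra.
have ypp : yp m.+2 <= Th * yp m.+1 + q m.+2.
  rewrite {1}/yp ge_max; apply/andP; split; first lra.
  by rewrite addr_ge0// mulr_ge0.
have := ler_wpM2l TW0 ypp.
set S := \sum_(_ <= _ < _) _; set s := \sum_(_ <= _ < _) _.
have : W * (Th * yp m.+1 + q m.+2) =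
  (1 + Th * W) * (Th * yp m.+1 + q m.+2) by rewrite -WE.
move: yhp; lra.
Qed.

End RealSequences.

(** * Inner product calculus, Young and Cauchy-Schwarz inequalities *)

Section InnerProduct.
Context {R : realType} {H : completeNormedModType R}.
Context (ip : {dot H for (@idfun R)}).
Implicit Types (x y z : H) (a : R).

Lemma ip_sym x y : ip x y = ip y x.
Proof. by rewrite hermC expr0 mul1r. Qed.

Lemma ipDl x y z : ip (x + y) z = ip x z + ip y z.
Proof. exact: linearDl. Qed.

Lemma ipZl a x z : ip (a *: x) z = a * ip x z.
Proof. exact: linearZl_LR. Qed.

Lemma ipNl x z : ip (- x) z = - ip x z.
Proof. exact: linearNl. Qed.

Lemma ipDr x y z : ip z (x + y) = ip z x + ip z y.
Proof. exact: linearDr. Qed.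

Lemma ipZr a x z : ip z (a *: x) = a * ip z x.
Proof. by rewrite ip_sym ipZl ip_sym. Qed.

Lemma ipNr x z : ip z (- x) = - ip z x.
Proof. exact: linearNr. Qed.

Definition ipE := (ipDl, ipDr, ipNl, ipNr, ipZl, ipZr).

Lemma ip_young x y a : hilbert ip -> 0 < a ->
  2 * ip x y <= a * `|x| ^+ 2 + a^-1 * `|y| ^+ 2.
Proof.
move=> hip a0.
have := sqr_ge0 `|a *: x - y|.
rewrite !hip !ipE.
rewrite (ip_sym y x) => h.
rewrite -(ler_pM2l a0) mulrDr (mulrA a a^-1) mulfV ?gt_eqF//.
lra.
Qed.

Lemma ip_cs x y : hilbert ip -> ip x y <= `|x| * `|y|.
Proof.
move=> hip.
have [->|x0] := eqVneq x 0; first by rewrite linear0l normr0 mul0r.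
have [->|y0] := eqVneq y 0; first by rewrite linear0r normr0 mulr0.
have nx : 0 < `|x| by rewrite normr_gt0.
have ny : 0 < `|y| by rewrite normr_gt0.
have := @ip_young x y (`|y| / `|x|) hip (divr_gt0 ny nx).
have -> : `|y| / `|x| * `|x| ^+ 2 + (`|y| / `|x|)^-1 * `|y| ^+ 2
    = 2 * (`|x| * `|y|) by field; rewrite !gt_eqF.
lra.
Qed.

End InnerProduct.

(** * Elementary facts on the time grid *)

Section Grid.
Context {R : realType}.
Context {t : nat -> R} {N : nat} {T : R} (tP : Defs.partition t N T).

Lemma partition_le i j : (i <= j <= N)%N -> t i <= t j.
Proof.
case: tP => _ _ tS; elim: j => [|j IHj] /andP[ij jN].
  by move: ij; rewrite leqn0 => /eqP ->.
have [->//|ne] := eqVneq i j.+1.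
apply: le_trans (ltW (tS j jN)); apply: IHj; lia.
Qed.

Lemma partition_mem j : (1 <= j <= N)%N -> t j \in `]0, T].
Proof.
move=> jN; case: (tP) => t0 tN tS; rewrite in_itv /=; apply/andP; split.
  rewrite -t0; apply: lt_le_trans (tS 0%N _) (@partition_le 1 j _); nat_lia.
by rewrite -tN; apply: partition_le; nat_lia.
Qed.

Lemma stp_gt0 j : (1 <= j <= N)%N -> 0 < stp t j.
Proof.
case: tP => _ _ tS; case: j => // j jN.
by rewrite /stp subr_gt0 /= tS.
Qed.

Lemma sum_stp m n : (1 <= m <= n.+1)%N ->
  \sum_(m <= j < n.+1) stp t j = t n - t m.-1.
Proof.
case: m => // m mn; rewrite big_add1 /= telescope_sumr//.
Qed.

Lemma stp_le j n : (1 <= j <= n)%N -> (n <= N)%N -> stp t j <= t n.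
Proof.
move=> jn nN; case: tP => t0 _ _.
have : t j <= t n by apply: partition_le; nat_lia.
have : t 0%N <= t j.-1 by apply: partition_le; nat_lia.
rewrite /stp t0; lra.
Qed.

Lemma stp_le_max j : (2 <= j <= N)%N -> stp t j <= stp_max t N.
Proof. by move=> jN; apply: le_bigmax_seq; rewrite ?mem_index_iota. Qed.

Lemma rat_le_max j : (2 <= j <= N)%N -> rat_stp t j <= rat_max t N.
Proof. by move=> jN; apply: le_bigmax_seq; rewrite ?mem_index_iota. Qed.

Lemma rat_gt0 j : (2 <= j <= N)%N -> 0 < rat_stp t j.
Proof. by move=> jN; rewrite divr_gt0// stp_gt0//; nat_lia. Qed.

End Grid.

(** * One-step energy inequalities, with no operator in sight *)

Section Energy.
Context {R : realType} {H : completeNormedModType R}.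
Context {ip : {dot H for (@idfun R)}} (hip : hilbert ip).
Context {t : nat -> R} {N : nat} {T : R} (tP : Defs.partition t N T).
Implicit Types (e E b d : nat -> H) (n : nat) (a g : R).

(** Here [E], [b], [d] stand for the square root of the operator applied to the error, the
    perturbation and the consistency error. The equation is tested with the difference quotient, and
    [2 (E n, E n - E n.-1)] dominates the difference of the squared norms. The weight [a] stays
    free, because it becomes the constant of the step size restriction. *)
Lemma bdiff_energy e E b d n a g : (2 <= n <= N)%N -> 0 < a ->
  `|b n| <= g * `|E n| ->
  ip (bdf2 t e n) (bdiff t e n) + (stp t n)^-1 * ip (E n) (E n - E n.-1)
    + ip (b n) (bdiff t e n) = ip (d n) (bdiff t e n) ->
  `|E n| ^+ 2 - `|E n.-1| ^+ 2
    + (7 / 4 - a^-1) * (stp t n * `|bdiff t e n| ^+ 2)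
  <= rat_stp t n ^+ 2 / (2 + 2 * rat_stp t n)
       * (stp t n.-1 * `|bdiff t e n.-1| ^+ 2)
     + a * (g ^+ 2 * stp t n) * `|E n| ^+ 2 + 4 * (stp t n * `|d n| ^+ 2).
Proof.
move=> nN a0 bE eq.
have k0 : 0 < stp t n by apply: (stp_gt0 tP); nat_lia.
have k1 : 0 < stp t n.-1 by apply: (stp_gt0 tP); nat_lia.
have r0 := rat_gt0 tP n nN.
set k := stp t n in eq k0 *; set k' := stp t n.-1 in k1 *.
set r := rat_stp t n in r0 *.
have kr : k = r * k' by rewrite /r /rat_stp -/k -/k' divfK ?gt_eqF.
move: eq; rewrite {1}/bdf2 /s_stp -/r.
move: (bdiff t e n) (bdiff t e n.-1) => x y.
set s := r / (1 + r) => eq.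
have s0 : 0 < s by rewrite divr_gt0// ; lra.
(* Twice the tested equation offers [2 + 2 s] copies of [|x|^2]. The coupling, weighted by [s],
   costs [2 s] of them, the consistency error [1 / 4] and the perturbation [a^-1]; this leaves
   [7 / 4 - a^-1]. *)
have xy := @ip_young _ _ ip y x 2^-1 hip ltac:(lra).
have bx := @ip_young _ _ ip (- b n) x a hip a0.
have dx := @ip_young _ _ ip (d n) x 4 hip ltac:(lra).
have EE := sqr_ge0 `|E n - E n.-1|.
rewrite invrK in xy.
have bE2 : `|b n| ^+ 2 <= g ^+ 2 * `|E n| ^+ 2.
  by rewrite -exprMn ler_pXn2r// nnegrE ?normr_ge0// (le_trans _ bE).
move: eq EE xy bx dx; rewrite normrN !hip !ipE -!hip (ip_sym _ (E n.-1) (E n)).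
set EE' := ip (E n) (E n.-1); set xx := `|x| ^+ 2; set yy := `|y| ^+ 2.
move=> eq EE xy bx dx.
have keq : k * ((1 + s) * xx - s * ip y x + ip (b n) x - ip (d n) x)
    + (`|E n| ^+ 2 - EE') = 0.
  rewrite -[X in _ + X = 0](mulVKf (lt0r_neq0 k0)) -mulrDr.
  by rewrite (_ : _ + _ = 0) ?mulr0//; lra.
have -> : r ^+ 2 / (2 + 2 * r) * (k' * yy) = k * (s * yy / 2).
  rewrite kr /s; field; lra.
have h1 := ler_wpM2l (ltW s0) xy.
have h2 := ler_wpM2l (ltW a0) bE2.
have : 0 <= k * (s * yy / 2 + a * (g ^+ 2 * `|E n| ^+ 2) + 4 * `|d n| ^+ 2
  - (7 / 4 - a^-1) * xx + 2 * ((1 + s) * xx - s * ip y x + ip (b n) x - ip (d n) x)).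
  apply: mulr_ge0; [exact: ltW|lra].
move: keq; lra.
Qed.

(** The equation is tested with [e n] and multiplied by the step, so that the scheme reads [(1 + s)
    (e n - e n.-1) - p (e n.-1 - e n.-2)] with [p = r s]. The contraction factor is [p / (1 + s)],
    and the hypothesis on the ratio says [p <= 1 + s]. *)
Lemma value_energy e E b d n a g : (2 <= n <= N)%N -> 0 < a ->
  rat_stp t n ^+ 2 <= 1 + 2 * rat_stp t n ->
  `|b n| <= g * `|E n| ->
  ip (bdf2 t e n) (e n) + `|E n| ^+ 2 + ip (b n) (e n) = ip (d n) (e n) ->
  (`|e n| ^+ 2 - `|e n.-1| ^+ 2) + stp t n * `|E n| ^+ 2 / 2
  <= rat_stp t n ^+ 2 / (1 + 2 * rat_stp t n)
       * (`|e n.-1| ^+ 2 - `|e n.-2| ^+ 2)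
     + (4 * `|e n.-1 - e n.-2| ^+ 2
     + stp t n * (g ^+ 2 + a) * `|e n| ^+ 2 + a^-1 * (stp t n * `|d n| ^+ 2)).
Proof.
move=> nN a0 rR bE eq.
have k0 : 0 < stp t n by apply: (stp_gt0 tP); nat_lia.
have k1 : 0 < stp t n.-1 by apply: (stp_gt0 tP); nat_lia.
have r0 := rat_gt0 tP n nN.
set k := stp t n in eq k0 *; set k' := stp t n.-1 in k1 *.
set r := rat_stp t n in r0 rR *.
have kr : k = r * k' by rewrite /r /rat_stp -/k -/k' divfK ?gt_eqF.
set s := r / (1 + r).
have s0 : 0 < s by rewrite divr_gt0// ; lra.
pose p := r - s.
have pE : p = r * s by rewrite /p /s; field; lra.
have p0 : 0 < p by rewrite pE mulr_gt0.
have p1 : p <= 1 + s.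
  rewrite pE -subr_ge0.
  have -> : 1 + s - r * s = (1 + 2 * r - r ^+ 2) / (1 + r) by rewrite /s; field; lra.
  by rewrite divr_ge0//; lra.
have s1 : s <= 1 by rewrite /s ler_pdivrMr; lra.
have kD : k *: bdf2 t e n = (1 + s) *: (e n - e n.-1) - p *: (e n.-1 - e n.-2).
  rewrite /bdf2 /s_stp -/r -/s /bdiff -/k -/k' scalerBr !scalerA.
  congr (_ *: _ - _ *: _); first by field; rewrite gt_eqF.
  by rewrite pE kr; field; rewrite gt_eqF.
have keq : ip (k *: bdf2 t e n) (e n) + k * (`|E n| ^+ 2 + ip (b n) (e n) - ip (d n) (e n)) = 0.
  by rewrite ipZl -mulrDr (_ : _ + _ = 0) ?mulr0//; lra.
rewrite kD in keq.
have be := @ip_cs _ _ ip (- b n) (e n) hip.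
have de := @ip_young _ _ ip (e n) (d n) a hip a0.
have ZZ := sqr_ge0 `|(e n - e n.-1) - (e n.-1 - e n.-2)|.
have Z0 := sqr_ge0 `|e n - e n.-1|.
have Z1 := sqr_ge0 `|e n.-1 - e n.-2|.
have be2 : 2 * (`|b n| * `|e n|) <= `|E n| ^+ 2 + g ^+ 2 * `|e n| ^+ 2.
  have := ler_wpM2r (normr_ge0 (e n)) bE.
  have := sqr_ge0 (`|E n| - g * `|e n|); nra.
move: keq be de be2 ZZ Z0 Z1; rewrite normrN !hip !ipE -!hip.
rewrite (ip_sym _ (e n.-1) (e n)) (ip_sym _ (e n.-2) (e n)).
rewrite (ip_sym _ (e n.-2) (e n.-1)) (ip_sym _ (e n) (d n)).
set A0 := `|e n| ^+ 2; set A1 := `|e n.-1| ^+ 2; set A2 := `|e n.-2| ^+ 2.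
set i01 := ip (e n) (e n.-1); set i02 := ip (e n) (e n.-2).
set i12 := ip (e n.-1) (e n.-2); set X := `|E n| ^+ 2.
set D := `|d n| ^+ 2; set be' := ip (b n) _; set de' := ip (d n) _.
move=> keq be de be2 ZZ Z0 Z1.
(* The mixed product of the two increments is split evenly. The current squared increment is then
   absorbed because [p <= 1 + s] ([h2]); the previous one appears with factor [2 p], at most 4
   ([h3]), and is kept as a source term. *)
have h1 : 0 <= p * (A0 - 2 * i01 + A1 + 2 * (A1 - 2 * i12 + A2) + (A1 - A2)
    - 2 * (i01 - i02)) by rewrite mulr_ge0//; lra.
have h2 : 0 <= (1 + s - p) * (A0 - 2 * i01 + A1) by rewrite mulr_ge0//; lra.
have h3 : 0 <= (2 - p) * (A1 - 2 * i12 + A2) by rewrite mulr_ge0//; lra.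
have h4 : 0 <= k * ((g ^+ 2 + a) * A0 + a^-1 * D + X + 2 * (be' - de')).
  by rewrite mulr_ge0 ?(ltW k0)//; lra.
have X0 : 0 <= X by apply: sqr_ge0.
have q0 : 0 <= 4 * (A1 - 2 * i12 + A2) + k * (g ^+ 2 + a) * A0 + a^-1 * (k * D).
  apply: addr_ge0; first apply: addr_ge0; first lra.
    rewrite mulr_ge0 ?sqr_ge0// mulr_ge0// ?(ltW k0)//.
    by have := sqr_ge0 g; lra.
  by rewrite !mulr_ge0 ?invr_ge0 ?sqr_ge0// ltW.
have main : (1 + s) * (A0 - A1) + k * X <= p * (A1 - A2)
   + (4 * (A1 - 2 * i12 + A2) + k * (g ^+ 2 + a) * A0 + a^-1 * (k * D)) by lra.
have -> : r ^+ 2 / (1 + 2 * r) = p / (1 + s).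
  by rewrite pE /s; field; lra.
have s1' : 0 < 1 + s by lra.
rewrite -(ler_pM2l s1').
have th : (1 + s) * (p / (1 + s) * (A1 - A2)) = p * (A1 - A2).
  by rewrite mulrA mulrCA divff ?mulr1// gt_eqF.
rewrite [X in _ <= X]mulrDr th.
(* Division by [1 + s], which lies between 1 and 2, does not increase the nonnegative source and
   keeps at least half of the dissipation. *)
have := mulr_ge0 (ltW s0) q0.
have : 0 <= (1 - s) * (k * X) by rewrite !mulr_ge0 ?(ltW k0)//; lra.
move: main; lra.
Qed.

(** Testing with [e 1] gives [|e 1|^2 / k + |E 1|^2] on the left, as [e 0 = 0]. The perturbation
    takes half of [|E 1|^2] and [g^2 |e 1|^2 / 2], the latter covered by the first term since
    [g^2 k < 1]. What remains is at most [|d 1| |e 1|], of order [k * k^2]. *)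
Lemma euler_energy e E b d g c5 c6 : (1 <= N)%N -> e 0%N = 0 ->
  `|b 1%N| <= g * `|E 1%N| -> g ^+ 2 * stp t 1 < 1 ->
  `|e 1%N| <= c5 * stp t 1 ^+ 2 -> `|d 1%N| <= c6 * stp t 1 ->
  ip (bdiff t e 1) (e 1%N) + `|E 1%N| ^+ 2 + ip (b 1%N) (e 1%N)
    = ip (d 1%N) (e 1%N) ->
  `|E 1%N| ^+ 2 <= 2 * c5 * c6 * stp t 1 ^+ 3.
Proof.
move=> N1 e0 bE gk e5 d6.
have k0 : 0 < stp t 1 by apply: (stp_gt0 tP); nat_lia.
rewrite /bdiff e0 subr0 ipZl -hip.
set k := stp t 1 in k0 gk e5 d6 *.
have be := @ip_cs _ _ ip (- b 1%N) (e 1%N) hip.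
have de := @ip_cs _ _ ip (d 1%N) (e 1%N) hip.
move: be; rewrite normrN ipNl => be eq.
have de2 : `|d 1%N| * `|e 1%N| <= c6 * k * (c5 * k ^+ 2) by apply: ler_pM.
have be2 : 2 * (`|b 1%N| * `|e 1%N|) <= `|E 1%N| ^+ 2 + g ^+ 2 * `|e 1%N| ^+ 2.
  have := ler_wpM2r (normr_ge0 (e 1%N)) bE.
  have := sqr_ge0 (`|E 1%N| - g * `|e 1%N|); nra.
have gk2 : g ^+ 2 * `|e 1%N| ^+ 2 <= k^-1 * `|e 1%N| ^+ 2.
  by rewrite ler_wpM2r ?sqr_ge0// -[_^-1]mul1r ler_pdivlMr// ltW.
have ek : 0 <= k^-1 * `|e 1%N| ^+ 2 by rewrite mulr_ge0 ?sqr_ge0// invr_ge0 ltW.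
lra.
Qed.

End Energy.

(** * Partially defined linear operators *)

Section LinearOperators.
Context {R : realType} {H : completeNormedModType R}.
Context {ip : {dot H for (@idfun R)}}.
Implicit Types (S : linop H) (x y : H) (a : R).

Lemma linop0 S : S 0 = 0.
Proof.
have := Defs.appP 1 (dom0 S) (dom0 S); rewrite !scale1r addr0.
by rewrite -[X in X = _]addr0 => /addrI.
Qed.

Lemma domZ S a x : dom S x -> dom S (a *: x).
Proof. by move=> Sx; have := Defs.domP a Sx (dom0 S); rewrite addr0. Qed.

Lemma linopZ S a x : dom S x -> S (a *: x) = a *: S x.
Proof.
by move=> Sx; have := Defs.appP a Sx (dom0 S); rewrite linop0 !addr0.
Qed.

Lemma domB S x y : dom S x -> dom S y -> dom S (x - y).
Proof. by move=> Sx Sy; have := Defs.domP (-1) Sy Sx; rewrite scaleN1r addrC. Qed.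

Lemma linopB S x y : dom S x -> dom S y -> S (x - y) = S x - S y.
Proof.
by move=> Sx Sy; have := Defs.appP (-1) Sy Sx; rewrite !scaleN1r addrC => ->; rewrite addrC.
Qed.

Lemma self_adjoint_ip S x y : self_adjoint ip S -> dom S x -> dom S y ->
  ip (S x) y = ip x (S y).
Proof. by move=> [_ /(_ y (S y))[adj _]] Sx Sy; apply: adj. Qed.

End LinearOperators.

(** * Linearity of the difference operators *)

Section Differences.
Context {R : realType} {H : normedModType R} {t : nat -> R}.
Implicit Types x y : nat -> H.

Lemma bdiffB x y n :
  bdiff t (fun j => x j - y j) n = bdiff t x n - bdiff t y n.
Proof. by rewrite /bdiff -scalerBr !opprD addrACA. Qed.

Lemma bdf2B x y n :
  bdf2 t (fun j => x j - y j) n = bdf2 t x n - bdf2 t y n.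
Proof. by rewrite /bdf2 !bdiffB !scalerBr !opprD addrACA. Qed.

End Differences.

(** * The error equation of the scheme *)

Section Setting.
Context {R : realType} {H : completeNormedModType R}.
Context {ip : {dot H for (@idfun R)}} {A sqrtA : linop H} {B : R -> H -> H}.
Context {gamma : R -> R} {gmax T : R} {f u du : R -> H}.
Context {N : nat} {t : nat -> R} {U : nat -> H} {c4 c5 c6 : R}.
Context (S : bdf2_setting ip A sqrtA B gamma gmax T f u du N t U c4 c5 c6).

Let e j := u (t j) - U j.
Let E j := sqrtA (e j).
Let b j := B (t j) (e j).
Let d j := bdf2 t (u \o t) j - du (t j).
Let tP := set_part S.
Let hip := set_hilbert S.
Let k := stp t.
Let kmax := stp_max t N.
Let g j := gamma (t j).
Let Y j := k j * `|bdiff t e j| ^+ 2.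

Lemma err0 : e 0%N = 0.
Proof. by rewrite /e (set_U0 S); case: tP => -> _ _; rewrite subrr. Qed.

Lemma dom_exact j : (1 <= j <= N)%N ->
  [/\ dom A (u (t j)), dom sqrtA (u (t j)) & dom sqrtA (sqrtA (u (t j)))].
Proof.
move=> jN; have Au := set_u_dom S (partition_mem tP j jN).
by case: (set_sqrt S) => _ _ /(_ (u (t j)))[/(_ Au)[]].
Qed.

Lemma dom_err j : (j <= N)%N -> dom sqrtA (e j).
Proof.
(* The exact solution is assumed to lie in [dom A] at positive times only; at time 0 the error
   vanishes. *)
case: j => [_|j jN]; first by rewrite err0; apply: dom0.
have [_ ? _] := dom_exact j.+1 jN.
by apply: domB => //; apply: (set_U_V S).
Qed.

(** The strong equation is put in the variational form of the scheme: [A] is the square of [sqrtA],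
    and one factor moves to [v] by self-adjointness. *)
Lemma exact_tested j v : (1 <= j <= N)%N -> dom sqrtA v ->
  ip (du (t j)) v + ip (sqrtA (u (t j))) (sqrtA v) + ip (B (t j) (u (t j))) v
  = ip (f (t j)) v.
Proof.
move=> jN Sv; have [Au Su SSu] := dom_exact j jN.
rewrite -(set_u_eq S (partition_mem tP j jN)) !ipDl.
case: (set_sqrt S) => adj _ _ /(_ _ Au) ->.
by rewrite (self_adjoint_ip _ _ _ adj SSu Sv).
Qed.

Lemma perturbation_bound j : (1 <= j <= N)%N -> `|b j| <= g j * `|E j|.
Proof.
by move=> jN; apply: (set_B_bound S (partition_mem tP j jN)); apply: dom_err; nat_lia.
Qed.

Lemma perturbationB j : (1 <= j <= N)%N ->
  b j = B (t j) (u (t j)) - B (t j) (U j).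
Proof.
move=> jN; have [_ Su _] := dom_exact j jN.
have SU : dom sqrtA (U j) by apply: (set_U_V S); nat_lia.
have := set_B_linear S (partition_mem tP j jN) (-1) SU Su.
by rewrite !scaleN1r addrC [RHS]addrC.
Qed.

Lemma operatorB j : (1 <= j <= N)%N -> E j = sqrtA (u (t j)) - sqrtA (U j).
Proof.
move=> jN; have [_ Su _] := dom_exact j jN.
by apply: linopB => //; apply: (set_U_V S); nat_lia.
Qed.

Lemma err_bdf2 j v : (2 <= j <= N)%N -> dom sqrtA v ->
  ip (bdf2 t e j) v + ip (E j) (sqrtA v) + ip (b j) v = ip (d j) v.
Proof.
move=> jN Sv; have jN1 : (1 <= j <= N)%N by nat_lia.
rewrite (bdf2B (u \o t) U) (operatorB j jN1) (perturbationB j jN1) /d.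
have := exact_tested j v jN1 Sv; have := set_bdf2 S jN Sv.
by move: (bdf2 t U j) (bdf2 t (u \o t) j) => x y; rewrite !ipE; lra.
Qed.

Lemma err_euler v : dom sqrtA v ->
  ip (bdiff t e 1) v + ip (E 1%N) (sqrtA v) + ip (b 1%N) v
  = ip (bdiff t (u \o t) 1 - du (t 1%N)) v.
Proof.
move=> Sv; have N1 : (1 <= 1 <= N)%N by have := set_N S; nat_lia.
rewrite (bdiffB (u \o t) U) (operatorB _ N1) (perturbationB _ N1).
have := exact_tested _ v N1 Sv; have := set_euler S Sv.
by move: (bdiff t U 1) (bdiff t (u \o t) 1) => x y; rewrite !ipE; lra.
Qed.

(** * Bounds on the data: starting errors and consistency errors *)

Lemma le_gmax j : (1 <= j <= N)%N -> g j ^+ 2 <= gmax ^+ 2.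
Proof.
move=> jN; have tj := partition_mem tP j jN.
have g0 := set_gamma_ge0 S tj; have [_ /(_ _ tj) gm] := set_gmax S.
by rewrite ler_pXn2r// nnegrE// (le_trans g0).
Qed.

Lemma k1_gt0 : 0 < k 1%N.
Proof. by apply: (stp_gt0 tP); have := set_N S; nat_lia. Qed.

Lemma kmax_gt0 : 0 < kmax.
Proof.
have N2 : (2 <= 2 <= N)%N by have := set_N S; nat_lia.
by apply: (lt_le_trans _ (stp_le_max 2 N2)); apply: (stp_gt0 tP); nat_lia.
Qed.

Lemma c5_ge0 : 0 <= c5.
Proof.
have := le_trans (normr_ge0 _) (set_c5 S).
by rewrite pmulr_lge0// exprn_gt0// k1_gt0.
Qed.

Lemma c6_ge0 : 0 <= c6.
Proof.
have := le_trans (normr_ge0 _) (set_c6 S).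
by rewrite pmulr_lge0// exprn_gt0// k1_gt0.
Qed.

Lemma err1_V : `|E 1%N| ^+ 2 <= 2 * c5 * c6 * k 1 ^+ 3.
Proof.
have N1 : (1 <= 1 <= N)%N by have := set_N S; nat_lia.
(* At index 1 the residual is that of the Euler step rather than [d 1]; only its value there
   matters, so a constant family carries it. *)
apply: (euler_energy hip tP e E b (fun=> bdiff t (u \o t) 1 - du (t 1%N)) (g 1%N)) => //.
- exact: err0.
- exact: perturbation_bound.
- exact: (set_gamma_k1 S).
- exact: (set_c5 S).
- have := set_c6 S; rewrite normrZ gtr0_norm ?k1_gt0// expr2 mulrCA.
  by rewrite ler_pM2l// k1_gt0.
- by rewrite hip err_euler//; apply: dom_err; nat_lia.
Qed.

Lemma err1_H : `|e 1%N| ^+ 2 <= c5 ^+ 2 * k 1 ^+ 4.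
Proof.
rewrite -[4%N]/(2 * 2)%N exprM -exprMn ler_pXn2r ?nnegrE// ?(set_c5 S)//.
by rewrite mulr_ge0 ?c5_ge0 ?sqr_ge0.
Qed.

(** As [e 0 = 0], [k 1 * Y 1] equals [|e 1|^2]; dividing by [k 1] costs one power. *)
Lemma err_Y1 : Y 1%N <= c5 ^+ 2 * k 1 ^+ 3.
Proof.
have k0 := k1_gt0.
rewrite -(ler_pM2l k0) (_ : k 1 * Y 1 = `|e 1%N| ^+ 2).
  by rewrite mulrCA -exprS err1_H.
rewrite /Y /bdiff err0 subr0 normrZ normfV gtr0_norm// exprMn.
by rewrite -/(k 1%N); field; rewrite gt_eqF.
Qed.

(** Each squared consistency error is at most [c4^2 kmax^4], and the steps from index 2 on sum to at
    most [t n]. *)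
Lemma consistency_sum m n : (m <= n <= N)%N ->
  \sum_(2 <= j < m.+1) k j * `|d j| ^+ 2 <= c4 ^+ 2 * kmax ^+ 4 * t n.
Proof.
move=> mnN.
have k0 j : (2 <= j <= N)%N -> 0 < k j by move=> jN; apply: (stp_gt0 tP); nat_lia.
apply: (@le_trans _ _ (\sum_(2 <= j < n.+1) c4 ^+ 2 * kmax ^+ 4 * k j)).
  apply: (@le_trans _ _ (\sum_(2 <= j < m.+1) c4 ^+ 2 * kmax ^+ 4 * k j)).
    apply: ler_sum_nat => j jm; have jN : (2 <= j <= N)%N by nat_lia.
    rewrite mulrC ler_wpM2r ?(ltW (k0 _ jN))//.
    apply: (@le_trans _ _ ((c4 * k j ^+ 2) ^+ 2)).
      rewrite ler_pXn2r ?nnegrE ?(set_c4 S jN)//.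
      exact: le_trans (normr_ge0 _) (set_c4 S jN).
    rewrite exprMn ler_wpM2l ?sqr_ge0// -exprM ler_pXn2r// ?nnegrE.
    - exact: stp_le_max.
    - exact: ltW (k0 _ jN).
    - exact: ltW kmax_gt0.
  have [m1|m1] := ltnP m 1.
    rewrite big_geq ?sum_nat_ge0 //=; last nat_lia.
    move=> j jn; rewrite mulr_ge0 ?(ltW (k0 _ _))//; last nat_lia.
    by rewrite mulr_ge0 ?sqr_ge0// exprn_ge0// ltW// kmax_gt0.
  apply: ler_sum_nat_widen => [|j jn]; first nat_lia.
  rewrite mulr_ge0 ?(ltW (k0 _ _))//; last nat_lia.
  by rewrite mulr_ge0 ?sqr_ge0// exprn_ge0// ltW// kmax_gt0.
rewrite -mulr_sumr ler_wpM2l//.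
  by rewrite mulr_ge0 ?sqr_ge0// exprn_ge0// ltW// kmax_gt0.
have [n1|n1] := ltnP n 1.
  have -> : n = 0%N by nat_lia.
  by rewrite big_geq//; case: tP => ->.
rewrite (sum_stp (t := t) 2 n)//= gerBl.
by case: tP => <- _ _; apply: (partition_le tP); have := set_N S; nat_lia.
Qed.

(** * Stability in the energy norm and for the difference quotients *)

Lemma Y_ge0 j : (1 <= j <= N)%N -> 0 <= Y j.
Proof. by move=> jN; rewrite mulr_ge0 ?sqr_ge0// ltW// (stp_gt0 tP). Qed.

Lemma derivative_stability_step a n : (2 <= n <= N)%N -> 0 < a ->
  `|E n| ^+ 2 - `|E n.-1| ^+ 2 + (7 / 4 - a^-1) * Y n
  <= rat_stp t n ^+ 2 / (2 + 2 * rat_stp t n) * Y n.-1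
     + a * (g n ^+ 2 * k n) * `|E n| ^+ 2 + 4 * (k n * `|d n| ^+ 2).
Proof.
move=> nN a0; apply: (bdiff_energy hip tP e E b d) => //.
  by apply: perturbation_bound; nat_lia.
have [Sn Sn1] : dom sqrtA (e n) /\ dom sqrtA (e n.-1).
  by split; apply: dom_err; nat_lia.
have Sx : dom sqrtA (e n - e n.-1) by apply: domB.
have Sd : sqrtA (bdiff t e n) = (stp t n)^-1 *: (E n - E n.-1).
  by rewrite /bdiff linopZ// linopB.
have := err_bdf2 n (bdiff t e n) nN (domZ _ _ _ Sx).
by rewrite Sd (ipZr _ _ _ (E n)).
Qed.

(** Majorant of [|E 1|^2 + 2 Y 1] plus four times the consistency sum: the constant term in the
    Gronwall argument. *)
Definition energy_data n : R :=
  (2 * c5 * c6 + 2 * c5 ^+ 2) * k 1 ^+ 3 + 4 * c4 ^+ 2 * t n * kmax ^+ 4.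

(** The dissipation [7 / 4 - a^-1] of a step is divided: [1 / 4] is kept in the sum, and
    [3 / 2 - a^-1] is carried over to absorb the coupling term of the next step, which is what the
    condition on the ratios allows. The bound [2 / 3 <= a] makes the carried part nonnegative. *)
Lemma derivative_stability a c1 n : (n <= N)%N -> 2 / 3 <= a ->
  (forall j, (2 <= j <= N)%N ->
     rat_stp t j ^+ 2 / (2 + 2 * rat_stp t j) + a^-1 <= 3 / 2) ->
  a * gmax ^+ 2 * kmax <= c1 -> c1 < 1 ->
  forall m, (1 <= m <= n)%N ->
  `|E m| ^+ 2 + (\sum_(2 <= j < m.+1) Y j) / 4
  <= energy_data n
     * expR (a / (1 - c1) * \sum_(2 <= j < n.+1) g j ^+ 2 * k j).
Proof.
move=> nN a23 ra ac1 c11.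
have a0 : 0 < a by lra.
have ia : a^-1 <= 3 / 2 by rewrite -[a^-1]mul1r ler_pdivrMr//; lra.
have k0 j : (1 <= j <= N)%N -> 0 < k j by move=> jN; apply: (stp_gt0 tP); nat_lia.
have tn0 : 0 <= t n by case: tP => <- _ _; apply: (partition_le tP); nat_lia.
have ed0 : 0 <= energy_data n.
  have ? := c5_ge0; have ? := c6_ge0.
  rewrite addr_ge0// mulr_ge0 ?exprn_ge0 ?(ltW kmax_gt0) ?(ltW k1_gt0)//.
    by rewrite addr_ge0 ?mulr_ge0 ?sqr_ge0.
  by rewrite mulr_ge0// mulr_ge0 ?sqr_ge0.
pose lam j := a * (g j ^+ 2 * k j).
have lam0 j : (1 <= j <= N)%N -> 0 <= lam j.
  by move=> jN; rewrite mulr_ge0 ?(ltW a0)// mulr_ge0 ?sqr_ge0// ltW// k0.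
have stab m : (1 <= m <= n)%N -> `|E m| ^+ 2 + (\sum_(2 <= j < m.+1) Y j) / 4
    <= energy_data n + \sum_(2 <= j < m.+1) lam j * `|E j| ^+ 2.
  move=> mn.
  (* The induction needs the carried dissipation [(3 / 2 - a^-1) * Y m] on the left; it is dropped
     afterwards. At [m = 1] it is covered by [2 * Y 1]. *)
  suff: `|E m| ^+ 2 + (\sum_(2 <= j < m.+1) Y j) / 4 + (3 / 2 - a^-1) * Y m
    <= (`|E 1%N| ^+ 2 + 2 * Y 1%N) + \sum_(2 <= j < m.+1) lam j * `|E j| ^+ 2
      + 4 * \sum_(2 <= j < m.+1) k j * `|d j| ^+ 2.
    have : 0 <= (3 / 2 - a^-1) * Y m.
      by rewrite mulr_ge0 ?Y_ge0//; [lra|nat_lia].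
    have := consistency_sum m n; rewrite nN andbT => /(_ (ltac:(nat_lia))).
    rewrite /energy_data; have := err1_V; have := err_Y1; lra.
  elim: m mn => // -[_ mn|m IHm mn].
    rewrite !big_geq// mulr0 mul0r !addr0 lerD2l ler_wpM2r ?Y_ge0//.
      by have := set_N S; nat_lia.
    by have : 0 < a^-1 by [rewrite invr_gt0|]; lra.
  have m2N : (2 <= m.+2 <= N)%N by nat_lia.
  rewrite !(big_nat_recr m.+2)//=.
  have := IHm (ltac:(nat_lia)); have := derivative_stability_step a m.+2 m2N a0.
  have := ler_wpM2r (Y_ge0 m.+1 (ltac:(nat_lia))) (ra _ m2N).
  rewrite /= /lam; lra.
move=> m mn; apply: (le_trans (stab m mn)).
have sY j : (1 <= j <= n)%N -> 0 <= \sum_(2 <= i < j.+1) Y i.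
  by move=> jn; apply: sum_nat_ge0 => i ij; apply: Y_ge0; nat_lia.
have lamc j : (2 <= j < n.+1)%N -> 0 <= lam j <= c1.
  move=> jn; rewrite lam0; last nat_lia.
  apply: le_trans ac1; rewrite -mulrA ler_wpM2l ?(ltW a0)//.
  apply: ler_pM; rewrite ?sqr_ge0 ?(ltW (k0 _ _)) ?le_gmax ?stp_le_max//; nat_lia.
have := @discrete_gronwall _ (fun j => `|E j| ^+ 2) lam (energy_data n) c1 2 n.+1
  ed0 c11 lamc _ m.+1 (ltac:(nat_lia)).
move=> /(_ _)/le_trans; apply.
  by move=> j jn; have := stab j (ltac:(nat_lia)); have := sY j (ltac:(nat_lia)); lra.
rewrite ler_wpM2l// ler_expR [_^-1 * _]mulrC.
rewrite (_ : a / (1 - c1) * _ = (\sum_(2 <= j < n.+1) lam j) / (1 - c1)).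
  apply: ler_wpM2r; first by rewrite invr_ge0; lra.
  by apply: ler_sum_nat_widen => [|j jn]; [nat_lia|apply: lam0; nat_lia].
by rewrite /lam -mulr_sumr; lra.
Qed.

Lemma t_gt0 n : (1 <= n <= N)%N -> 0 < t n.
Proof. by move=> /(partition_mem tP); rewrite in_itv /= => /andP[]. Qed.

(** For (iii), where [gamma] enters the constant through its maximum. *)
Lemma sum_gamma_le n : (n <= N)%N ->
  \sum_(2 <= j < n.+1) g j ^+ 2 * k j <= gmax ^+ 2 * t n.
Proof.
move=> nN.
have tn0 : 0 <= t n by case: tP => <- _ _; apply: (partition_le tP); nat_lia.
have [n1|n1] := ltnP n 1; first by rewrite big_geq ?(leqW n1)// mulr_ge0 ?sqr_ge0.
apply: (@le_trans _ _ (\sum_(2 <= j < n.+1) gmax ^+ 2 * k j)).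
  apply: ler_sum_nat => j jn; apply: ler_wpM2r.
    by apply/ltW/(stp_gt0 tP); nat_lia.
  by apply: le_gmax; nat_lia.
rewrite -mulr_sumr (sum_stp (t := t) 2 n)//= ler_wpM2l ?sqr_ge0// gerBl.
by apply/ltW/t_gt0; have := set_N S; nat_lia.
Qed.

(** * Stability in the norm of the Hilbert space *)

Lemma value_stability_step a n : (2 <= n <= N)%N -> 0 < a ->
  rat_stp t n ^+ 2 <= 1 + 2 * rat_stp t n ->
  (`|e n| ^+ 2 - `|e n.-1| ^+ 2) + k n * `|E n| ^+ 2 / 2
  <= rat_stp t n ^+ 2 / (1 + 2 * rat_stp t n)
       * (`|e n.-1| ^+ 2 - `|e n.-2| ^+ 2)
     + (4 * `|e n.-1 - e n.-2| ^+ 2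
     + k n * (g n ^+ 2 + a) * `|e n| ^+ 2 + a^-1 * (k n * `|d n| ^+ 2)).
Proof.
move=> nN a0 rR; apply: (value_energy hip tP e E b d) => //.
  by apply: perturbation_bound; nat_lia.
by rewrite hip err_bdf2//; apply: dom_err; nat_lia.
Qed.

(** Summing the contraction telescopes the differences of squared norms, and Gronwall removes the
    terms in [|e j|^2]. The squared increments enter only through a bound [z], supplied later by the
    energy estimate. *)
Lemma value_stability Th z n : (2 <= n <= N)%N -> 0 <= Th < 1 ->
  (forall j, (2 <= j <= N)%N ->
     rat_stp t j ^+ 2 / (1 + 2 * rat_stp t j) <= Th) ->
  2 * ((1 - Th)^-1 * (gmax ^+ 2 * kmax)) <= 1 ->
  \sum_(1 <= j < n) `|e j - e j.-1| ^+ 2 <= z ->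
  forall m, (1 <= m <= n)%N ->
  `|e m| ^+ 2 + (\sum_(2 <= j < m.+1) k j * `|E j| ^+ 2) / 2
  <= (1 - Th)^-1 * (c5 ^+ 2 * k 1 ^+ 4 + 4 * z
       + 4 * (1 - Th)^-1 * c4 ^+ 2 * t n ^+ 2 * kmax ^+ 4)
     * expR (4 * ((1 - Th)^-1 * (gmax ^+ 2 * t n) + 1 / 4)).
Proof.
move=> nN Th01 rTh gk zn.
have /andP[Th0 Th1] := Th01.
set W := (1 - Th)^-1 in gk *.
have W0 : 0 < W by rewrite invr_gt0 subr_gt0.
have WE : W = 1 + Th * W by rewrite /W; field; lra.
have tn0 : 0 < t n by apply: t_gt0; nat_lia.
have k0 j : (1 <= j <= N)%N -> 0 < k j by move=> jN; apply: (stp_gt0 tP); nat_lia.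
have rp j : (2 <= j <= N)%N -> 0 < 1 + 2 * rat_stp t j.
  by move=> jN; have := rat_gt0 tP j jN; lra.
(* With this weight and [k j <= t n], the consistency part of [lam j] is at most [1 / 4]; the
   perturbation part is at most [1 / 2] by hypothesis. Hence [lam j <= 3 / 4], and Gronwall brings
   the factor 4 in the exponent. *)
pose a := (4 * W * t n)^-1.
have a0 : 0 < a by rewrite invr_gt0 !mulr_gt0.
pose y j := `|e j| ^+ 2 - `|e j.-1| ^+ 2.
pose h j := k j * `|E j| ^+ 2 / 2.
pose lam j := W * (k j * (g j ^+ 2 + a)).
pose dd j := a^-1 * (k j * `|d j| ^+ 2).
pose q j := 4 * `|e j.-1 - e j.-2| ^+ 2
  + k j * (g j ^+ 2 + a) * `|e j| ^+ 2 + dd j.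
set Q := W * _.
have lam0 j : (1 <= j <= N)%N -> 0 <= lam j.
  move=> jN; rewrite mulr_ge0 ?(ltW W0)// mulr_ge0 ?(ltW (k0 _ jN))//.
  by rewrite addr_ge0 ?sqr_ge0 ?ltW.
have dd0 j : (1 <= j <= N)%N -> 0 <= dd j.
  move=> jN; apply: mulr_ge0; first by rewrite invr_ge0 ltW.
  by apply: mulr_ge0; [apply/ltW/k0|apply: sqr_ge0].
have z0 j : (j <= n)%N -> \sum_(1 <= i < j) `|e i - e i.-1| ^+ 2 <= z.
  move=> jn; apply: le_trans zn.
  have [j1|j1] := ltnP j 1.
    by rewrite big_geq ?(ltnW j1)//; apply: sum_nat_ge0 => i _; apply: sqr_ge0.
  by apply: ler_sum_nat_widen => [|i _]; [nat_lia|apply: sqr_ge0].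
have zge0 : 0 <= z by have := z0 1%N (ltac:(nat_lia)); rewrite big_geq.
have Wa j : (1 <= j <= n)%N -> W * (k j * a) <= 1 / 4.
  move=> jn; rewrite /a (_ : W * _ = k j / t n / 4); last first.
    by field; rewrite !gt_eqF.
  by rewrite ler_wpM2r// ler_pdivrMr// mul1r; apply: (stp_le tP); nat_lia.
have lam1 j : (2 <= j < n.+1)%N -> 0 <= lam j <= 3 / 4.
  move=> jn; rewrite lam0 /=; last nat_lia.
  have := Wa j (ltac:(nat_lia)).
  have : W * (g j ^+ 2 * k j) <= W * (gmax ^+ 2 * kmax).
    rewrite ler_wpM2l ?(ltW W0)//.
    apply: ler_pM; rewrite ?sqr_ge0 ?(ltW (k0 _ _)) ?le_gmax ?stp_le_max//; nat_lia.
  rewrite /lam; lra.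
have stab m : (1 <= m <= n)%N ->
    `|e m| ^+ 2 + (\sum_(2 <= j < m.+1) k j * `|E j| ^+ 2) / 2
    <= Q + \sum_(2 <= j < m.+1) lam j * `|e j| ^+ 2.
  move=> mn.
  have contr j : (2 <= j <= n)%N ->
      [/\ 0 <= rat_stp t j ^+ 2 / (1 + 2 * rat_stp t j) <= Th, 0 <= h j,
        0 <= q j &
        y j + h j <= rat_stp t j ^+ 2 / (1 + 2 * rat_stp t j) * y j.-1 + q j].
    move=> jn; have jN : (2 <= j <= N)%N by nat_lia.
    have jN1 : (1 <= j <= N)%N by nat_lia.
    split.
    - by rewrite rTh// andbT divr_ge0 ?sqr_ge0 ?(ltW (rp _ _)).
    - by rewrite /h !mulr_ge0 ?invr_ge0 ?(ltW (k0 _ jN1)).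
    - rewrite addr_ge0 ?dd0// addr_ge0 ?mulr_ge0 ?(ltW (k0 _ jN1)) //.
      by rewrite addr_ge0 ?sqr_ge0 ?ltW.
    - apply: value_stability_step => //; rewrite -[leRHS]mul1r.
      by rewrite -ler_pdivrMr ?rp//; apply: ltW; apply: le_lt_trans (rTh _ _) Th1.
  have y1E : y 1%N = `|e 1%N| ^+ 2 by rewrite /y /= err0 normr0 expr0n /= subr0.
  have y1 : 0 <= y 1%N by rewrite y1E sqr_ge0.
  have := sum_contraction y h q _ Th n Th01 contr y1 m mn.
  rewrite big_split /= -/W y1E.
  have -> : \sum_(2 <= j < m.+1) y j = `|e m| ^+ 2 - `|e 1%N| ^+ 2.
    rewrite big_add1 /= /y; case: (m) mn => // m' _.
    by rewrite telescope_sumr.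
  rewrite /h -mulr_suml /q !big_split /= -!mulr_sumr.
  have -> : \sum_(2 <= j < m.+1) `|e j.-1 - e j.-2| ^+ 2
      = \sum_(1 <= j < m) `|e j - e j.-1| ^+ 2 by rewrite big_add1.
  have -> : \sum_(2 <= j < m.+1) lam j * `|e j| ^+ 2
      = W * \sum_(2 <= j < m.+1) k j * (g j ^+ 2 + a) * `|e j| ^+ 2.
    by rewrite mulr_sumr; apply: eq_bigr => j _; rewrite /lam !mulrA.
  have := ler_wpM2l (ltW W0) (z0 m (ltac:(nat_lia))).
  have c := consistency_sum m n (ltac:(nat_lia)).
  have := ler_wpM2l (mulr_ge0 (ltW W0) (ltac:(by rewrite invr_ge0 ltW) : 0 <= a^-1)) c.
  have := ler_wpM2l (ltW W0) err1_H.
  (* The telescoped [|e 1|^2] and the contribution [Th * W * y 1] of the contraction combine into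
     [W * |e 1|^2]. *)
  have : W * `|e 1%N| ^+ 2 = `|e 1%N| ^+ 2 + Th * W * `|e 1%N| ^+ 2.
    by rewrite {1}WE mulrDl mul1r.
  rewrite /Q {1 2}/a invrK.
  lra.
move=> m mn; apply: (le_trans (stab m mn)).
have Q0 : 0 <= Q.
  have k4 : 0 <= k 1 ^+ 4 by rewrite exprn_ge0// ltW// k1_gt0.
  have m4 : 0 <= kmax ^+ 4 by rewrite exprn_ge0// ltW// kmax_gt0.
  apply: mulr_ge0; first exact: ltW.
  apply: addr_ge0; first by apply: addr_ge0; [rewrite mulr_ge0 ?sqr_ge0|lra].
  apply: mulr_ge0 => //; apply: mulr_ge0; last exact: sqr_ge0.
  by apply: mulr_ge0; [lra|exact: sqr_ge0].
have := @discrete_gronwall _ (fun j => `|e j| ^+ 2) lam Q (3 / 4) 2 n.+1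
  Q0 (ltac:(lra)) lam1 _ m.+1 (ltac:(nat_lia)).
move=> /(_ _)/le_trans; apply.
  move=> j jn; have := stab j (ltac:(nat_lia)).
  have : 0 <= \sum_(2 <= i < j.+1) k i * `|E i| ^+ 2.
    by apply: sum_nat_ge0 => i ij; rewrite mulr_ge0 ?sqr_ge0 ?(ltW (k0 _ _))//; nat_lia.
  lra.
rewrite ler_wpM2l// ler_expR (_ : (1 - 3 / 4)^-1 = 4); last by field.
rewrite ler_wpM2l//.
apply: (@le_trans _ _ (\sum_(2 <= j < n.+1) lam j)).
  by apply: ler_sum_nat_widen => [|j jn]; [nat_lia|apply: lam0; nat_lia].
have -> : \sum_(2 <= j < n.+1) lam j
    = W * (\sum_(2 <= j < n.+1) g j ^+ 2 * k j) + W * a * \sum_(2 <= j < n.+1) k j.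
  by rewrite !mulr_sumr -big_split /=; apply: eq_bigr => j _; rewrite /lam; lra.
rewrite lerD//.
  by rewrite ler_wpM2l ?(ltW W0)//; apply: sum_gamma_le; nat_lia.
rewrite (sum_stp (t := t) 2 n) /=; last nat_lia.
apply: (@le_trans _ _ (W * a * t n)).
  rewrite ler_wpM2l ?mulr_ge0 ?(ltW W0) ?(ltW a0)// gerBl.
  by apply/ltW/t_gt0; have := set_N S; nat_lia.
by rewrite /a (_ : W * _ * _ = 1 / 4)//; field; rewrite !gt_eqF.
Qed.

(** A squared increment is [k j * Y j], so the bound on the sum of the [Y j] gains a factor of step
    size; this raises [k_1^3] to fourth order. *)
Lemma increment_sum X n : (2 <= n <= N)%N ->
  \sum_(2 <= j < n.+1) Y j <= 4 * (energy_data n * X) -> 0 <= X ->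
  \sum_(1 <= j < n) `|e j - e j.-1| ^+ 2
  <= c5 ^+ 2 * k 1 ^+ 4
     + 4 * ((2 * c5 * c6 + 2 * c5 ^+ 2 + 4 * c4 ^+ 2 * t n ^+ 2) * X
            * (k 1 ^+ 4 + kmax ^+ 4)).
Proof.
move=> nN sY X0.
have k0 j : (1 <= j <= N)%N -> 0 < k j by move=> jN; apply: (stp_gt0 tP); nat_lia.
have tn0 : 0 < t n by apply: t_gt0; nat_lia.
have m0 := kmax_gt0; have k10 := k1_gt0.
rewrite big_ltn; last nat_lia.
rewrite /= err0 subr0 lerD ?err1_H//.
(* Both bounds on the step are needed: [kmax] against [k 1 ^+ 3], and [t n] against the term already
   of order [kmax ^+ 4], so that the constant depends on [t n] and not on [kmax]. *)
pose K := Num.min kmax (t n).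
have K0 : 0 < K by rewrite lt_min m0.
apply: (@le_trans _ _ (\sum_(2 <= j < n) K * Y j)).
  apply: ler_sum_nat => j jn.
  rewrite (_ : `|e j - e j.-1| ^+ 2 = k j * Y j).
    rewrite ler_wpM2r ?Y_ge0//; first nat_lia.
    by rewrite le_min (stp_le_max j) ?(stp_le tP)//; nat_lia.
  rewrite /Y /bdiff normrZ normfV gtr0_norm ?k0//; last nat_lia.
  by rewrite -/(k j); field; rewrite gt_eqF ?k0//; nat_lia.
rewrite -mulr_sumr.
apply: (@le_trans _ _ (K * (4 * (energy_data n * X)))).
  rewrite ler_wpM2l ?(ltW K0)//; apply: le_trans sY.
  by apply: ler_sum_nat_widen => [|j jn]; [nat_lia|apply: Y_ge0; nat_lia].
have kp : 0 <= k 1 ^+ 3 by rewrite exprn_ge0 ?(ltW k10).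
have kp4 : 0 <= k 1 ^+ 4 by rewrite exprn_ge0 ?(ltW k10).
have mp : 0 <= kmax ^+ 4 by rewrite exprn_ge0 ?(ltW m0).
(* The maximum [kmax] runs over indices from 2 on, so either of [kmax] and [k 1] may be the
   larger. *)
have kk : kmax * k 1 ^+ 3 <= k 1 ^+ 4 + kmax ^+ 4.
  have [mk|km] := leP kmax (k 1).
    rewrite -[leLHS]addr0 lerD//.
    by rewrite [leRHS]exprS ler_wpM2r.
  rewrite -[leLHS]add0r lerD//.
  by rewrite [leRHS]exprS ler_wpM2l ?(ltW m0)// ler_pXn2r ?nnegrE ?(ltW m0) ?(ltW k10)// ltW.
have A0 : 0 <= 2 * c5 * c6 + 2 * c5 ^+ 2.
  by rewrite addr_ge0 ?mulr_ge0 ?c5_ge0 ?c6_ge0.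
have Ked : K * energy_data n <= (2 * c5 * c6 + 2 * c5 ^+ 2 + 4 * c4 ^+ 2 * t n ^+ 2)
    * (k 1 ^+ 4 + kmax ^+ 4).
  have h1 : K * ((2 * c5 * c6 + 2 * c5 ^+ 2) * k 1 ^+ 3)
      <= (2 * c5 * c6 + 2 * c5 ^+ 2) * (k 1 ^+ 4 + kmax ^+ 4).
    rewrite mulrCA ler_wpM2l//; apply: le_trans kk.
    by rewrite ler_wpM2r// ge_min lexx.
  have h2 : K * (4 * c4 ^+ 2 * t n * kmax ^+ 4)
      <= 4 * c4 ^+ 2 * t n ^+ 2 * (k 1 ^+ 4 + kmax ^+ 4).
    have q0 : 0 <= c4 ^+ 2 by apply: sqr_ge0.
    apply: (@le_trans _ _ (t n * (4 * c4 ^+ 2 * t n * kmax ^+ 4))).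
      rewrite ler_wpM2r ?ge_min ?lexx ?orbT//.
      apply: mulr_ge0 => //; apply: mulr_ge0; last exact: ltW.
      by rewrite mulr_ge0.
    rewrite (_ : t n * _ = 4 * c4 ^+ 2 * t n ^+ 2 * kmax ^+ 4); last by ring.
    rewrite ler_wpM2l ?lerDr//; apply: mulr_ge0; last exact: sqr_ge0.
    by rewrite mulr_ge0.
  rewrite /energy_data; lra.
have := ler_wpM2r X0 Ked; lra.
Qed.

End Setting.

(** * From pointwise bounds to discrete norms, and monotonicity in the step ratio *)

Section Norms.
Context {R : realType} {H : normedModType R}.
Implicit Types (x : nat -> H) (nrm : H -> R).

Lemma linf_sqr_le nrm x M m n : 0 <= M -> (forall v, 0 <= nrm v) ->
  (forall j, (m <= j <= n)%N -> nrm (x j) ^+ 2 <= M) ->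
  linf nrm x m n ^+ 2 <= M.
Proof.
move=> M0 nrm0 xM; rewrite -[leRHS]sqr_sqrtr// ler_pXn2r ?nnegrE ?sqrtr_ge0//.
  rewrite /linf big_nat; apply: bigmax_le; first exact: sqrtr_ge0.
  by move=> j jn; rewrite -[leLHS]ger0_norm// -sqrtr_sqr ler_wsqrtr// xM; nat_lia.
by rewrite /linf; elim/big_ind : _ => // u v u0 v0; rewrite le_max u0.
Qed.

End Norms.

(** Replaces every step ratio by its upper bound, in the coupling factor ([a = b = 2]) and in the
    contraction factor ([a = 1], [b = 2]). *)
Lemma ler_sqr_over_affine (R : realType) (a b r s : R) : 0 < a -> 0 <= b ->
  0 < r -> r <= s -> r ^+ 2 / (a + b * r) <= s ^+ 2 / (a + b * s).
Proof.
move=> a0 b0 r0 rs; have s0 : 0 < s by lra.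
have br : 0 <= b * r by rewrite mulr_ge0// ltW.
have bs : 0 <= b * s by rewrite mulr_ge0// ltW.
rewrite ler_pdivrMr; last lra.
rewrite mulrAC ler_pdivlMr; last lra.
have h1 : 0 <= a * (s ^+ 2 - r ^+ 2).
  by rewrite mulr_ge0 ?(ltW a0)// subr_ge0 ler_pXn2r ?nnegrE ?(ltW r0) ?(ltW s0).
have h2 : 0 <= b * r * (s * (s - r)).
  by rewrite mulr_ge0// mulr_ge0 ?(ltW s0)// subr_ge0.
nra.
Qed.

(** * Estimates in terms of the constants of the theorem *)

Section Bounds.
Context {R : realType} {H : completeNormedModType R}.
Context {ip : {dot H for (@idfun R)}} {A sqrtA : linop H} {B : R -> H -> H}.
Context {gamma : R -> R} {gmax T : R} {f u du : R -> H}.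
Context {N : nat} {t : nat -> R} {U : nat -> H} {c4 c5 c6 : R}.
Context (S : bdf2_setting ip A sqrtA B gamma gmax T f u du N t U c4 c5 c6).

Let e j := u (t j) - U j.
Let tP := set_part S.
Let k := stp t.
Let kmax := stp_max t N.

(** In (iii) the argument [tn] is the square of the time, because bounding a step by [t n]
    contributes a second factor. *)
Definition energy_const (tn c4 c5 c6 : R) : R :=
  2 * c5 * c6 + 2 * c5 ^+ 2 + 4 * c4 ^+ 2 * tn.

Lemma energy_const_ge0 (x : R) : 0 <= x -> 0 <= energy_const x c4 c5 c6.
Proof.
move=> x0; have q4 := sqr_ge0 c4; have c50 := c5_ge0 S; have c60 := c6_ge0 S.
have q5 := sqr_ge0 c5.
by apply: addr_ge0; [apply: addr_ge0|]; apply: mulr_ge0 => //; apply: mulr_ge0.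
Qed.

Lemma energy_data_le n : (1 <= n <= N)%N ->
  0 <= @energy_data R N t c4 c5 c6 n
    <= energy_const (t n) c4 c5 c6 * (kmax ^+ 4 + k 1 ^+ 3).
Proof.
move=> nN; have tn0 := t_gt0 S n nN.
have k3 : 0 <= k 1 ^+ 3 by rewrite exprn_ge0// ltW// (k1_gt0 S).
have m4 : 0 <= kmax ^+ 4 by rewrite exprn_ge0// ltW// (kmax_gt0 S).
have P0 : 0 <= 2 * c5 * c6 + 2 * c5 ^+ 2.
  by rewrite addr_ge0 ?mulr_ge0 ?(c5_ge0 S) ?(c6_ge0 S).
have Q0 : 0 <= 4 * c4 ^+ 2 * t n.
  by rewrite mulr_ge0 ?(ltW tn0)// mulr_ge0 ?sqr_ge0.
have h1 := mulr_ge0 P0 k3; have h2 := mulr_ge0 P0 m4.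
have h3 := mulr_ge0 Q0 k3; have h4 := mulr_ge0 Q0 m4.
by rewrite /energy_const /energy_data -/(k 1) -/kmax; apply/andP; split; lra.
Qed.

(** The constants of the statement carry the prefactor [a / (1 - c1)], which is at least [a] because
    the step restriction forces [0 <= c1]. *)
Lemma gronwall_ge a c1 n : 0 < a -> a * gmax ^+ 2 * kmax <= c1 -> c1 < 1 ->
  expR (a / (1 - c1) * \sum_(2 <= j < n.+1) gamma (t j) ^+ 2 * stp t j)
    <= gronwall t gamma a c1 n / a.
Proof.
move=> a0 ac c11; rewrite /gronwall; set X := expR _.
have X0 : 0 < X by apply: expR_gt0.
have c10 : 0 <= c1.
  apply: le_trans ac; apply: mulr_ge0; last exact: ltW (kmax_gt0 S).
  by rewrite mulr_ge0 ?sqr_ge0// ltW.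
rewrite (_ : a / (1 - c1) * X / a = X / (1 - c1)); last first.
  by field; rewrite gt_eqF//=; lra.
by rewrite ler_pdivlMr; [nra|lra].
Qed.

Lemma energy_bound a c1 n : (2 <= n <= N)%N -> 2 / 3 <= a ->
  (forall j, (2 <= j <= N)%N ->
     rat_stp t j ^+ 2 / (2 + 2 * rat_stp t j) + a^-1 <= 3 / 2) ->
  a * gmax ^+ 2 * kmax <= c1 -> c1 < 1 ->
  forall m, (1 <= m <= n)%N ->
  `|sqrtA (e m)| ^+ 2
    + (\sum_(2 <= j < m.+1) stp t j * `|bdiff t e j| ^+ 2) / 4
  <= energy_const (t n) c4 c5 c6 * (gronwall t gamma a c1 n / a)
     * (kmax ^+ 4 + k 1 ^+ 3).
Proof.
move=> nN a23 ra ac c11 m mn.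
have a0 : 0 < a by lra.
have /andP[ed0 ed] := energy_data_le n (ltac:(nat_lia)).
apply: (le_trans (derivative_stability S a c1 n (ltac:(nat_lia)) a23 ra ac c11 m mn)).
rewrite [leRHS]mulrAC.
by apply: ler_pM => //; apply: gronwall_ge.
Qed.

Lemma linf_V_le M n : 0 <= M ->
  (forall j, (1 <= j <= n)%N -> `|sqrtA (e j)| ^+ 2 <= M) ->
  linf (normV sqrtA) e 1 n ^+ 2 <= M.
Proof. by move=> M0; apply: linf_sqr_le => // v; apply: normr_ge0. Qed.

Lemma l2_sqr (nrm : H -> R) n : (n <= N)%N ->
  l2 t nrm e 1 n ^+ 2 = \sum_(1 <= j < n.+1) stp t j * nrm (e j) ^+ 2.
Proof.
move=> nN; rewrite sqr_sqrtr// sum_nat_ge0// => j jn.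
by rewrite mulr_ge0 ?sqr_ge0// ltW// (stp_gt0 tP)//; nat_lia.
Qed.

Lemma rat_le_bound Rb j : rat_max t N <= Rb -> (2 <= j <= N)%N ->
  0 < rat_stp t j /\ rat_stp t j <= Rb.
Proof.
by move=> rR jN; rewrite (rat_gt0 tP)//; split => //; apply: le_trans (rat_le_max _ _) rR.
Qed.

End Bounds.

(** The number [(3 + sqrt 17) / 2] is the positive root of [x^2 - 3 x - 2]. *)
Lemma bdf2_R1_gt0 {R : realType} {Rb : R} : 1 < Rb ->
  Rb < (3 + Num.sqrt 17) / 2 -> 0 < 2 + 3 * Rb - Rb ^+ 2.
Proof.
move=> R1 RR; have s0 : 0 <= Num.sqrt (17 : R) by apply: sqrtr_ge0.
have s2 : Num.sqrt (17 : R) ^+ 2 = 17 by rewrite sqr_sqrtr.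
have [h|h] := leP (2 * Rb - 3) 0; first by nra.
have : (2 * Rb - 3) ^+ 2 < Num.sqrt (17 : R) ^+ 2.
  by rewrite ltr_pXn2r ?nnegrE ?(ltW h)//; lra.
rewrite s2; lra.
Qed.

(** The number [1 + sqrt 2] is the positive root of [x^2 - 2 x - 1]. *)
Lemma bdf2_R0_sqr {R : realType} {Rb : R} : 1 < Rb ->
  Rb < Num.sqrt 2 + 1 -> Rb ^+ 2 < 1 + 2 * Rb.
Proof.
move=> R1 RR; have s0 : 0 <= Num.sqrt (2 : R) by apply: sqrtr_ge0.
have s2 : Num.sqrt (2 : R) ^+ 2 = 2 by rewrite sqr_sqrtr.
have : (Rb - 1) ^+ 2 < Num.sqrt (2 : R) ^+ 2.
  by rewrite ltr_pXn2r ?nnegrE//; lra.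
rewrite s2; lra.
Qed.

(** Below [1 + sqrt 2] the coupling factor is at most 1, and the inverse weight is at most
    [1 / 2]. *)
Lemma bdf2_R0_bound {R : realType} {N : nat} {t : nat -> R} {T Rb : R} :
  Defs.partition t N T -> 1 < Rb -> Rb < Num.sqrt 2 + 1 -> rat_max t N <= Rb ->
  2 / 3 <= 4 + 2 * Num.sqrt (2 : R) /\
  forall j, (2 <= j <= N)%N -> rat_stp t j ^+ 2 / (2 + 2 * rat_stp t j)
    + (4 + 2 * Num.sqrt (2 : R))^-1 <= 3 / 2.
Proof.
move=> tP R1 RR rR; have s0 : 0 <= Num.sqrt (2 : R) by apply: sqrtr_ge0.
split=> [|j jN]; first lra.
have r0 := rat_gt0 tP j jN.
have rRb : rat_stp t j <= Rb by apply: le_trans (rat_le_max _ _) rR.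
have := @ler_sqr_over_affine R 2 2 _ _ ltac:(lra) ltac:(lra) r0 rRb.
have : Rb ^+ 2 / (2 + 2 * Rb) <= 1.
  by have := bdf2_R0_sqr R1 RR; rewrite ler_pdivrMr; lra.
have : (4 + 2 * Num.sqrt (2 : R))^-1 <= 1 / 2.
  by rewrite -[_^-1]mul1r ler_pdivrMr; lra.
lra.
Qed.

(** * The three error estimates *)

Theorem corollary4p6 (R : realType) :
  (exists C : R -> R -> R -> R -> R -> R -> R,
    forall (H : completeNormedModType R) (ip : {dot H for (@idfun R)})
      (A sqrtA : linop H) (B : R -> H -> H) (gamma : R -> R) (gmax T : R)
      (f u du : R -> H) (N : nat) (t : nat -> R) (U : nat -> H)
      (c4 c5 c6 : R),
    bdf2_setting ip A sqrtA B gamma gmax T f u du N t U c4 c5 c6 ->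
    forall n : nat, (2 <= n <= N)%N ->
    forall Rb cR c1 : R,
    1 < Rb -> Rb < (3 + Num.sqrt 17) / 2 -> rat_max t N <= Rb ->
    Num.max ((2 + 2 * Rb) / (2 + Rb))
            ((2 + 2 * Rb) / (2 + 3 * Rb - Rb ^+ 2)) < cR ->
    cR * gmax ^+ 2 * stp_max t N <= c1 -> c1 < 1 ->
    let e := fun j : nat => u (t j) - U j in
    l2 t (normV sqrtA) e 1 n ^+ 2 + linf (normV sqrtA) e 1 n ^+ 2
      <= C (gronwall t gamma cR c1 n) (t n) c4 c5 c6 cR
         * (stp_max t N ^+ 4 + stp t 1 ^+ 3))
  /\
  (exists C : R -> R -> R -> R -> R -> R -> R,
    forall (H : completeNormedModType R) (ip : {dot H for (@idfun R)})
      (A sqrtA : linop H) (B : R -> H -> H) (gamma : R -> R) (gmax T : R)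
      (f u du : R -> H) (N : nat) (t : nat -> R) (U : nat -> H)
      (c4 c5 c6 : R),
    bdf2_setting ip A sqrtA B gamma gmax T f u du N t U c4 c5 c6 ->
    forall n : nat, (2 <= n <= N)%N ->
    forall Rb c1 s1 : R,
    1 < Rb -> Rb < Num.sqrt 2 + 1 -> rat_max t N <= Rb ->
    (4 + 2 * Num.sqrt 2) * gmax ^+ 2 * stp_max t N <= c1 -> c1 < 1 ->
    0 <= s1 <= 1 ->
    let e := fun j : nat => u (t j) - U j in
    l2HH t s1 e 1 n ^+ 2 + linf (normV sqrtA) e 1 n ^+ 2
      <= C (gronwall t gamma (4 + 2 * Num.sqrt 2) c1 n) (t n) c4 c5 c6
           (rat_stp t 2)
         * (stp_max t N ^+ 4 + stp t 1 ^+ 3))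
  /\
  (exists C : R -> R -> R -> R -> R -> R -> R -> R -> R -> R -> R,
    forall (H : completeNormedModType R) (ip : {dot H for (@idfun R)})
      (A sqrtA : linop H) (B : R -> H -> H) (gamma : R -> R) (gmax T : R)
      (f u du : R -> H) (N : nat) (t : nat -> R) (U : nat -> H)
      (c4 c5 c6 : R),
    bdf2_setting ip A sqrtA B gamma gmax T f u du N t U c4 c5 c6 ->
    forall n : nat, (2 <= n <= N)%N ->
    forall Rb c1 c2 : R,
    1 < Rb -> Rb < Num.sqrt 2 + 1 -> rat_max t N <= Rb ->
    let c3 := (1 + Rb) ^+ 2 / (1 + 2 * Rb - Rb ^+ 2) in
    (4 + 2 * Num.sqrt 2) * gmax ^+ 2 * stp_max t N <= c1 -> c1 < 1 ->
    2 * c3 * gmax ^+ 2 * stp_max t N <= c2 -> c2 < 1 ->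
    let e := fun j : nat => u (t j) - U j in
    linf Num.norm e 1 n ^+ 2 + l2 t (normV sqrtA) e 1 n ^+ 2
      <= C gmax c1 c2 c3 c4 c5 c6 Rb (t n) (Phi t n)
         * (stp t 1 ^+ 4 + stp_max t N ^+ 4)).
Proof.
split; [|split].
(* The summand 1 serves the maximum norm; [tn] serves the l2 norm, bounded by the maximum over steps
   of total length [t n]. *)
- exists (fun G tn c4 c5 c6 cR => (tn + 1) * (energy_const tn c4 c5 c6 * (G / cR))).
  move=> H ip A sqrtA B gamma gmax T f u du N t U c4 c5 c6 S n nN Rb cR c1.
  move=> R1 RR rR; rewrite gt_max => /andP[cR1 cR2] ac c11.
  lazy zeta; set e := fun j : nat => u (t j) - U j.
  have n1N : (1 <= n <= N)%N by nat_lia.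
  have D0 := bdf2_R1_gt0 R1 RR.
  have d1 : 0 < 2 + 2 * Rb by lra.
  have cR23 : 2 / 3 <= cR.
    have : 1 <= (2 + 2 * Rb) / (2 + Rb) by rewrite ler_pdivlMr; lra.
    lra.
  have cR0 : 0 < cR by lra.
  have ra j : (2 <= j <= N)%N ->
      rat_stp t j ^+ 2 / (2 + 2 * rat_stp t j) + cR^-1 <= 3 / 2.
    move=> jN; have [r0 rRb] := rat_le_bound S Rb j rR jN.
    have := @ler_sqr_over_affine R 2 2 _ _ ltac:(lra) ltac:(lra) r0 rRb.
    (* This is the second lower bound on [cR]; the first one gave [1 <= cR]. *)
    have : cR^-1 <= (2 + 3 * Rb - Rb ^+ 2) / (2 + 2 * Rb).
      rewrite -[leRHS]invrK lef_pV2 ?posrE// ?invr_gt0 ?divr_gt0//.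
      by rewrite invf_div ltW.
    have : Rb ^+ 2 / (2 + 2 * Rb) + (2 + 3 * Rb - Rb ^+ 2) / (2 + 2 * Rb) <= 3 / 2.
      by rewrite -mulrDl ler_pdivrMr//; lra.
    lra.
  have bnd := energy_bound S cR c1 n nN cR23 ra ac c11.
  set M := energy_const _ _ _ _ * _ in bnd *.
  set K := stp_max t N ^+ 4 + stp t 1 ^+ 3 in bnd *.
  have V m : (1 <= m <= n)%N -> `|sqrtA (e m)| ^+ 2 <= M * K.
    move=> mn; apply: le_trans (bnd m mn).
    rewrite lerDl mulr_ge0 ?invr_ge0// sum_nat_ge0// => j jm.
    by rewrite mulr_ge0 ?sqr_ge0// ltW// (stp_gt0 (set_part S))//; nat_lia.
  have MK0 : 0 <= M * K by apply: le_trans (V n _); [exact: sqr_ge0|nat_lia].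
  rewrite -mulrA mulrDl mul1r lerD//; last exact: linf_V_le.
  rewrite (l2_sqr S)//; last nat_lia.
  apply: (@le_trans _ _ (\sum_(1 <= j < n.+1) stp t j * (M * K))).
    apply: ler_sum_nat => j jn; rewrite ler_wpM2l ?V//.
    by rewrite ltW// (stp_gt0 (set_part S))//; nat_lia.
  rewrite -mulr_suml (sum_stp (t := t) 1 n) /=; last nat_lia.
  by case: (set_part S) => -> _ _; rewrite subr0.
(* The factor 5 is 1 for the maximum norm plus 4 for the sum of the quotients, which the energy
   bound controls with weight [1 / 4]. The term [c5 ^+ 2] covers the quotient at index 1, outside
   that sum. *)
- exists (fun G tn c4 c5 c6 r2 =>
    5 * (energy_const tn c4 c5 c6 * (G / (4 + 2 * Num.sqrt 2))) + c5 ^+ 2).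
  move=> H ip A sqrtA B gamma gmax T f u du N t U c4 c5 c6 S n nN Rb c1 s1.
  move=> R1 RR rR ac c11 /andP[s10 s11].
  lazy zeta; set e := fun j : nat => u (t j) - U j.
  have [a23 ra] := bdf2_R0_bound (set_part S) R1 RR rR.
  have bnd := energy_bound S _ c1 n nN a23 ra ac c11.
  set M := energy_const _ _ _ _ * _ in bnd *.
  set K := stp_max t N ^+ 4 + stp t 1 ^+ 3 in bnd *.
  have k0 j : (1 <= j <= N)%N -> 0 < stp t j.
    by move=> jN; apply: (stp_gt0 (set_part S)).
  have sY0 m : (m <= n)%N ->
      0 <= \sum_(2 <= j < m.+1) stp t j * `|bdiff t e j| ^+ 2.
    move=> mn; apply: sum_nat_ge0 => j jm.
    by rewrite mulr_ge0 ?sqr_ge0// ltW// k0//; nat_lia.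
  have V m : (1 <= m <= n)%N -> `|sqrtA (e m)| ^+ 2 <= M * K.
    move=> mn; apply: le_trans (bnd m mn).
    by rewrite lerDl mulr_ge0 ?invr_ge0// sY0//; nat_lia.
  have MK0 : 0 <= M * K by apply: le_trans (V n _); [exact: sqr_ge0|nat_lia].
  have sY : \sum_(2 <= j < n.+1) stp t j * `|bdiff t e j| ^+ 2 <= 4 * (M * K).
    by have := bnd n (ltac:(nat_lia)); have := sqr_ge0 `|sqrtA (e n)|; rewrite -/e; lra.
  have Y1 : stp t 1 * `|bdiff t e 1| ^+ 2 <= c5 ^+ 2 * K.
    apply: (le_trans (err_Y1 S)); rewrite ler_wpM2l ?sqr_ge0// lerDr.
    by rewrite exprn_ge0// ltW// (kmax_gt0 S).
  rewrite (_ : _ * K = (c5 ^+ 2 * K + 4 * (M * K)) + M * K); last by ring.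
  rewrite lerD//; last exact: linf_V_le.
  have sw j : (2 <= j <= N)%N -> 0 <= s_stp t j <= 1.
    move=> jN; have [r0 _] := rat_le_bound S Rb j rR jN.
    have r1 : 0 < 1 + rat_stp t j by lra.
    by rewrite /s_stp divr_ge0 ?(ltW r0) ?(ltW r1)//= ler_pdivrMr//; lra.
  have w0 j : (1 <= j <= N)%N -> 0 <= (if j == 1%N then s1 else s_stp t j) <= 1.
    by move=> jN; case: eqP => [_|j1]; [apply/andP|apply: sw; move: j1; nat_lia].
  rewrite sqr_sqrtr; last first.
    apply: sum_nat_ge0 => j jn; have /andP[w1 _] := w0 j (ltac:(nat_lia)).
    by rewrite mulr_ge0 ?sqr_ge0// mulr_ge0// ltW// k0//; nat_lia.
  apply: (@le_trans _ _ (\sum_(1 <= j < n) stp t j * `|bdiff t e j| ^+ 2)).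
    apply: ler_sum_nat => j jn; rewrite ler_wpM2r ?sqr_ge0//.
    have /andP[_ w1] := w0 j (ltac:(nat_lia)).
    by rewrite ler_piMr// ltW// k0//; nat_lia.
  rewrite big_ltn; last nat_lia.
  rewrite lerD//; apply: le_trans sY; apply: ler_sum_nat_widen; first nat_lia.
  by move=> j jn; rewrite mulr_ge0 ?sqr_ge0// ltW// k0//; nat_lia.
(* In [5 * c5 ^+ 2], one copy comes from [|e 1|^2] and four from the first increment; 16 is 4 from
   the contraction times 4 from the energy bound. The factor 3 adds the maximum norm and twice the
   halved l2 sum; [2 * c5 * c6] is the l2 term at index 1. *)
- exists (fun gm c1 c2 c3 c4 c5 c6 Rb tn _ =>
    let W := (1 - Rb ^+ 2 / (1 + 2 * Rb))^-1 in
    let a := 4 + 2 * Num.sqrt 2 in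
    let G := expR (a / (1 - c1) * (gm ^+ 2 * tn)) in
    3 * (W * (5 * c5 ^+ 2 + 16 * (energy_const (tn ^+ 2) c4 c5 c6 * G)
              + 4 * W * c4 ^+ 2 * tn ^+ 2)
         * expR (4 * (W * (gm ^+ 2 * tn) + 1 / 4))) + 2 * c5 * c6).
  move=> H ip A sqrtA B gamma gmax T f u du N t U c4 c5 c6 S n nN Rb c1 c2.
  move=> R1 RR rR c3 ac c11 gc c21.
  lazy zeta; set e := fun j : nat => u (t j) - U j.
  set a := 4 + 2 * Num.sqrt 2; set W := (1 - Rb ^+ 2 / (1 + 2 * Rb))^-1.
  set G := expR (a / _ * _).
  have n1N : (1 <= n <= N)%N by nat_lia.
  have [a23 ra] := bdf2_R0_bound (set_part S) R1 RR rR.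
  have RR2 := bdf2_R0_sqr R1 RR.
  have tn0 := t_gt0 S n n1N.
  have k0 j : (1 <= j <= N)%N -> 0 < stp t j.
    by move=> jN; apply: (stp_gt0 (set_part S)).
  have k10 := k1_gt0 S; have m0 := kmax_gt0 S.
  set k1 := stp t 1 in k10 *; set m := stp_max t N in m0 gc ac *.
  have d2 : 0 < 1 + 2 * Rb by lra.
  set Th := Rb ^+ 2 / (1 + 2 * Rb) in W *.
  have Th01 : 0 <= Th < 1.
    by rewrite divr_ge0 ?sqr_ge0 ?(ltW d2)//= ltr_pdivrMr// mul1r.
  have W0 : 0 < W by rewrite invr_gt0 subr_gt0; case/andP: Th01.
  have rTh j : (2 <= j <= N)%N ->
      rat_stp t j ^+ 2 / (1 + 2 * rat_stp t j) <= Th.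
    move=> jN; have [r0 rRb] := rat_le_bound S Rb j rR jN.
    by apply: ler_sqr_over_affine => //; lra.
  (* Since [W = (1 + 2 R) / (1 + 2 R - R^2)] with [R] the ratio bound, the restriction stated with
     [c3] implies the one needed for [W]. *)
  have Wc3 : W <= c3.
    have -> : W = (1 + 2 * Rb) / (1 + 2 * Rb - Rb ^+ 2).
      rewrite /W -invf_div; congr (_^-1).
      by rewrite /Th mulrBl divff// gt_eqF.
    rewrite /c3 ler_wpM2r ?invr_ge0; [by []|lra|].
    by have := sqr_ge0 Rb; lra.
  have gm0 : 0 <= gmax ^+ 2 * m by rewrite mulr_ge0 ?sqr_ge0// ltW.
  have gk : 2 * (W * (gmax ^+ 2 * m)) <= 1.
    by have := ler_wpM2r gm0 Wc3; move: gc c21; lra.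
  have ca : 0 <= a / (1 - c1) by rewrite divr_ge0//; move: a23 c11; rewrite -/a; lra.
  have G0 : 0 <= G by apply/ltW/expR_gt0.
  have sY : \sum_(2 <= j < n.+1) stp t j * `|bdiff t e j| ^+ 2
      <= 4 * (@energy_data R N t c4 c5 c6 n * G).
    have := derivative_stability S a c1 n (ltac:(nat_lia)) a23 ra ac c11 n (ltac:(nat_lia)).
    have /andP[ed0 _] := energy_data_le S n n1N.
    have : expR (a / (1 - c1) * \sum_(2 <= j < n.+1) gamma (t j) ^+ 2 * stp t j) <= G.
      by rewrite ler_expR ler_wpM2l// (sum_gamma_le S)//; nat_lia.
    move/(ler_wpM2l ed0); have := sqr_ge0 `|sqrtA (e n)|; rewrite -/e; lra.
  have zn := increment_sum S G n nN sY G0.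
  have bnd := value_stability S Th _ n nN Th01 rTh gk zn.
  rewrite -/W -/k1 -/m in bnd.
  set X := expR (4 * _) in bnd *; set K := k1 ^+ 4 + m ^+ 4.
  set P := energy_const _ _ _ _; rewrite -/P.
  set M := W * _ * X.
  have X0 : 0 <= X by apply/ltW/expR_gt0.
  have k14 : 0 <= k1 ^+ 4 by rewrite exprn_ge0// ltW.
  have m4 : 0 <= m ^+ 4 by rewrite exprn_ge0// ltW.
  have P0 : 0 <= P by apply: (energy_const_ge0 S); apply: sqr_ge0.
  have q5 := sqr_ge0 c5.
  have Wct : 0 <= 4 * W * c4 ^+ 2 * t n ^+ 2.
    by rewrite mulr_ge0 ?sqr_ge0// mulr_ge0 ?sqr_ge0// mulr_ge0// ltW.
  have bnd' j : (1 <= j <= n)%N -> `|e j| ^+ 2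
      + (\sum_(2 <= i < j.+1) stp t i * `|sqrtA (e i)| ^+ 2) / 2 <= M * K.
    move=> jn; apply: (le_trans (bnd j jn)).
    rewrite /M [leRHS]mulrAC ler_wpM2r// -[leRHS]mulrA ler_wpM2l ?(ltW W0)//.
    have h1 := mulr_ge0 q5 m4; have h2 := mulr_ge0 Wct k14.
    rewrite -/(energy_const (t n ^+ 2) c4 c5 c6) -/P -/K; rewrite /K; lra.
  have sX0 j : (j <= n)%N ->
      0 <= \sum_(2 <= i < j.+1) stp t i * `|sqrtA (e i)| ^+ 2.
    move=> jn; apply: sum_nat_ge0 => i ij.
    by rewrite mulr_ge0 ?sqr_ge0// ltW// k0//; nat_lia.
  have V j : (1 <= j <= n)%N -> `|e j| ^+ 2 <= M * K.
    by move=> jn; have := bnd' j jn; have := sX0 j (ltac:(nat_lia)); lra.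
  have MK0 : 0 <= M * K by apply: le_trans (V n _); [exact: sqr_ge0|nat_lia].
  rewrite (_ : _ * K = M * K + (2 * c5 * c6 * K + 2 * (M * K))); last by ring.
  rewrite lerD//; first exact: linf_sqr_le.
  rewrite (l2_sqr S)//; last nat_lia.
  rewrite big_ltn; last nat_lia.
  rewrite lerD//.
    have := ler_wpM2l (ltW k10) (err1_V S).
    have : 0 <= 2 * c5 * c6 * m ^+ 4.
      by rewrite mulr_ge0// mulr_ge0 ?(c6_ge0 S)// mulr_ge0 ?(c5_ge0 S).
    by rewrite -/k1 -/e /normV /K exprS; lra.
  have := bnd' n (ltac:(nat_lia)); have := sqr_ge0 `|e n|; rewrite /normV; lra.
Qed.
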